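(* Let $p$ be a prime, $n\ge1$, $G=\langle\sigma\rangle\simeq\mathbb{Z}/p^n\mathbb{Z}$, and suppose $K/F$ is a Galois extension with $\mathrm{Gal}(K/F)=\langle\sigma\rangle$ such that $K$ contains a primitive $p$-th root of unity. Let $A\simeq\bigoplus_{i=1}^{p^n}\bigoplus_{d_i}\mathbb{F}_p[G]/(\sigma-1)^i$ be a finite $\mathbb{F}_p[G]$-module and define $\lceil A\rceil=\bigoplus_{i=1}^{p^n}\bigoplus_{d_i}\mathbb{F}_p[G]/(\sigma-1)^{p^{\lceil\log_p i\rceil}}$. If $F\in\mathfrak{F}(A\rtimes G)$, then $F\in\mathfrak{F}(\lceil A\rceil\rtimes G)$.
   Context: For a finite group $H$, $\mathfrak{F}(H)$ is the class of fields $F$ admitting a Galois extension $L/F$ with $\mathrm{Gal}(L/F)\simeq H$. Semidirect products are formed with respect to the given $G$-action on the module. *)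

(* Defs.v *)
From HB Require Import structures.
From mathcomp Require Import all_boot all_order all_algebra all_fingroup.
From mathcomp Require Import all_solvable all_field all_character.

Set Implicit Arguments.
Unset Strict Implicit.
Unset Printing Implicit Defensive.

Import GRing.Theory.
Local Open Scope ring_scope.

(* F \in \mathfrak{F}(H). The base field F sits in L as the subfield 1. *)
Definition realizes (F : fieldType) (gT : finGroupType) (H : {group gT}) :
    Prop :=
  exists L : splittingFieldType F,
    galois 1 {:L} /\ 'Gal({:L} / 1) \isog H.

(* A finite F_p[G]-module is a matrix representation of G on 'rV['F_p]_m;     *)
(* 'MR rG is the associated action of G on the additive group 'rV['F_p]_m.    *)
Definition modsdprod (p : nat) (gT : finGroupType) (G : {group gT}) (m : nat)
    (rG : mx_representation 'F_p G m) :
    {group sdprod_by ('MR rG)%gact} :=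
  [set: sdprod_by ('MR rG)%gact]%G.

Section CyclicModules.

Variables (p : nat) (gT : finGroupType) (s : gT).

Local Notation aG := (regular_repr 'F_p <[s]>%g).

(* Coordinates of (s - 1) ^+ i \in F_p[<[s]>] in the basis <[s]>: aG embeds   *)
(* the group ring in a matrix ring and gring_row reads off the coordinates.   *)
Definition aug_pow (i : nat) : 'rV['F_p]_#|<[s]>%g| :=
  gring_row ((aG s - 1%:M) ^+ i).

(* F_p[<[s]>] / ((s - 1) ^+ i) *)
Definition cyc_mod (i : nat) : representation 'F_p <[s]>%G :=
  Representation (factmod_repr (cyclic_mx_module aG (aug_pow i))).

(* \bigoplus_(1 <= i <= N) \bigoplus_(d i) F_p[<[s]>] / ((s - 1) ^+ (e i)) *)
Definition cyc_sum (N : nat) (d e : nat -> nat) : representation 'F_p <[s]>%G :=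
  \big[dadd_grepr/grepr0]_(1 <= i < N.+1) muln_grepr (cyc_mod (e i)) (d i).

(* up_log p i is the ceiling of log_p i. *)
Definition ceil_mod (N : nat) (d : nat -> nat) : representation 'F_p <[s]>%G :=
  cyc_sum N d (fun i => (p ^ up_log p i)%N).

End CyclicModules.

(* Main.v *)
(* As [K : F] is a power of p, F contains the p-th roots of unity. Let K1 be  *)
(* the fixed field of A in an A ><| G-extension of F, and s a generator of    *)
(* its Galois group over F. By Kummer theory the extension corresponds to a   *)
(* G-equivariant embedding phi of the dual of A in K1^* / K1^*p; conversely   *)
(* the extension attached to such a phi is split iff each value of phi whose  *)
(* norm to F is a p-th power in K1 has norm a p-th power in F: this makes     *)
(* t ^+ #[s], for a lift t of s, a norm for the action of s on A, so that t   *)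
(* can be corrected to have order #[s].                                       *)
(*   A generator x of a summand of length i, with p ^ k < i < p ^ k.+1, must  *)
(* thus be replaced by some w of length p ^ k.+1 with the same socle and with *)
(* the same norm condition; the sum stays direct because the socles remain    *)
(* independent. The condition on x and Hilbert 90 show that the socle is the  *)
(* class of some f in F, and that x' = (s - 1) ^ (i - 1 - p ^ k) x is the     *)
(* class of an element of the field fixed by s ^+ (p ^ k.+1), multiplied by f *)
(* under s ^+ (p ^ k). Comparing p-th roots of norms, f is a norm N(y) for    *)
(* s ^+ (p ^ k). As f is fixed by s, the norm of (s - 1) y is 1, so it equals *)
(* (s ^+ (p ^ k) - 1) w by Hilbert 90, and (s - 1) ^ (p ^ k.+1 - 1) w = f.    *)
Require Import Defs.
From HB Require Import structures.
From mathcomp Require Import all_boot all_algebra all_fingroup.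
From mathcomp Require Import all_solvable all_field all_character.
From mathcomp Require Import ring zify.
From Stdlib Require Import Morphisms Classical.

Set Implicit Arguments.
Unset Strict Implicit.
Unset Printing Implicit Defensive.

Import GRing.Theory.
Local Open Scope ring_scope.

(** * Power classes *)

Definition eq_pow (p : nat) (K : fieldType) (x y : K) : Prop :=
  exists2 u, u != 0 & x = y * u ^+ p.

Notation "x ~[ p ] y" := (eq_pow p x y)
  (at level 70, no associativity, format "x  ~[ p ]  y") : ring_scope.

Section PowerClasses.

Variables (p : nat) (K : fieldType).
Implicit Types x y u v w : K.

#[export] Instance eq_pow_equivalence : Equivalence (@eq_pow p K).
Proof.
split=> [x | x y [u nzu ->] | x y w [u nzu ->] [v nzv ->]].
- by exists 1; rewrite ?oner_eq0 // expr1n mulr1.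
- exists u^-1; first by rewrite invr_eq0.
  by rewrite exprVn mulfK ?expf_neq0.
- exists (v * u); first by rewrite mulf_neq0.
  by rewrite exprMn mulrA.
Qed.

#[export] Instance eq_powM :
  Proper (@eq_pow p K ==> @eq_pow p K ==> @eq_pow p K) *%R.
Proof.
move=> x y [u nzu ->] x' y' [v nzv ->].
by exists (u * v); [rewrite mulf_neq0 | rewrite exprMn mulrACA].
Qed.

#[export] Instance eq_powX :
  Proper (@eq_pow p K ==> eq ==> @eq_pow p K) (@GRing.exp K).
Proof.
move=> x y [u nzu ->] n _ <-; exists (u ^+ n); first by rewrite expf_neq0.
by rewrite exprMn -!exprM mulnC.
Qed.

#[export] Instance eq_powV :
  Proper (@eq_pow p K ==> @eq_pow p K) (@GRing.inv K).
Proof.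
move=> x y [u nzu ->]; exists u^-1; first by rewrite invr_eq0.
by rewrite invfM exprVn.
Qed.

Lemma eq_pow_refl x : x ~[p] x.
Proof. by reflexivity. Qed.
Hint Resolve eq_pow_refl : core.

Lemma eq_pow_mul_exp x u : u != 0 -> x * u ^+ p ~[p] x.
Proof. by exists u. Qed.

Lemma eq_pow_exp u : u != 0 -> u ^+ p ~[p] 1.
Proof. by move=> nzu; rewrite -[u ^+ p]mul1r eq_pow_mul_exp. Qed.

Lemma eq_pow_neq0 x y : x ~[p] y -> (x == 0) = (y == 0).
Proof.
by case=> u nzu ->; rewrite mulf_eq0 expf_eq0 (negPf nzu) andbF orbF.
Qed.

Lemma eq_pow_prod (I : Type) (r : seq I) (P : pred I) (f g : I -> K) :
    (forall i, P i -> f i ~[p] g i) ->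
  \prod_(i <- r | P i) f i ~[p] \prod_(i <- r | P i) g i.
Proof.
by move=> fg; elim/big_ind2: _ => [|x y x' y' -> ->|i /fg] //.
Qed.

Lemma eq_pow_prod1 (I : Type) (r : seq I) (P : pred I) (f : I -> K) :
  (forall i, P i -> f i ~[p] 1) -> \prod_(i <- r | P i) f i ~[p] 1.
Proof.
by move=> f1; elim/big_ind: _ => [|x y -> ->|i /f1] //; rewrite mulr1.
Qed.

Lemma eq_pow_modn n x : x != 0 -> x ^+ (n %% p) ~[p] x ^+ n.
Proof.
move=> nzx; rewrite {2}(divn_eq n p) exprD exprM.
by rewrite eq_pow_exp ?expf_neq0 // mul1r.
Qed.

End PowerClasses.

#[export] Hint Resolve eq_pow_refl : core.

Lemma val_FpD (p : nat) (a b : 'F_p) :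
  prime p -> (a + b)%R = ((a + b) %% p)%N :> nat.
Proof. by move=> p_pr; rewrite /= [X in (_ %% X)%N](Fp_cast p_pr). Qed.

Lemma val_FpM (p : nat) (a b : 'F_p) :
  prime p -> (a * b)%R = ((a * b) %% p)%N :> nat.
Proof. by move=> p_pr; rewrite /= [X in (_ %% X)%N](Fp_cast p_pr). Qed.

(** * Norms along powers of an automorphism *)

Lemma big_cycle (R : Type) (idx : R) (op : Monoid.com_law idx)
    (gT : finGroupType) (g : gT) (f : gT -> R) :
  \big[op/idx]_(x in <[g]>%g) f x = \big[op/idx]_(i < #[g]%g) f (g ^+ i)%g.
Proof.
have injX : injective (fun i : 'I_#[g]%g => (g ^+ i)%g).
  move=> i j /eqP; rewrite eq_expg_mod_order !modn_small // => /eqP.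
  exact: val_inj.
rewrite -(big_imset f (in2W injX)) /=; apply: eq_bigl => x.
apply/idP/imsetP => [/cyclePmin[i lt_i ->] | [i _ ->]]; last exact: mem_cycle.
by exists (Ordinal lt_i).
Qed.

Section GaloisElements.

Variables (F : fieldType) (K : splittingFieldType F).
Implicit Types (s g : gal_of {:K}) (x y : K).

#[export] Instance gal_eq_pow p s : Proper (@eq_pow p K ==> @eq_pow p K) s.
Proof.
move=> x y [u nzu ->]; exists (s u); first by rewrite fmorph_eq0.
by rewrite rmorphM rmorphXn.
Qed.

Lemma galM_full s g x : (s * g)%g x = g (s x).
Proof. by rewrite galM ?memvf. Qed.

Lemma galK_full s : cancel s s^-1%g.
Proof. by move=> x; rewrite -galM_full mulgV gal_id. Qed.

Lemma galVK_full s : cancel s^-1%g s.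
Proof. by move=> x; rewrite -galM_full mulVg gal_id. Qed.

Lemma galXS s i x : (s ^+ i.+1)%g x = s ((s ^+ i)%g x).
Proof. by rewrite expgSr galM_full. Qed.

Lemma galXD s i j x : (s ^+ (i + j))%g x = (s ^+ i)%g ((s ^+ j)%g x).
Proof. by rewrite addnC expgD galM_full. Qed.

Lemma gal_neq0 s x : x != 0 -> s x != 0.
Proof. by rewrite fmorph_eq0. Qed.

Lemma gal_fixX s i x : s x = x -> (s ^+ i)%g x = x.
Proof. by move=> sx; elim: i => [|i IHi]; rewrite ?gal_id // galXS IHi. Qed.

Lemma gal_commute s g x : commute s g -> g (s x) = s (g x).
Proof. by move=> sg; rewrite -2!galM_full sg. Qed.

Lemma mem_gal_full s : s \in 'Gal({:K} / 1)%g.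
Proof. by rewrite gal_kHom ?sub1v // k1AHom. Qed.

Definition cnorm s r x := \prod_(i < r) (s ^+ i)%g x.

Lemma cnormS s r x : cnorm s r.+1 x = cnorm s r x * (s ^+ r)%g x.
Proof. by rewrite /cnorm big_ord_recr. Qed.

Lemma cnorm0 s x : cnorm s 0 x = 1.
Proof. by rewrite /cnorm big_ord0. Qed.

Lemma cnormM s r : {morph cnorm s r : x y / x * y}.
Proof.
by move=> x y; rewrite /cnorm -big_split; apply: eq_bigr => i _;
  rewrite rmorphM.
Qed.

Lemma cnormX s r n : {morph cnorm s r : x / x ^+ n}.
Proof.
by move=> x; rewrite /cnorm -prodrXl; apply: eq_bigr => i _; rewrite rmorphXn.
Qed.

Lemma cnormV s r : {morph cnorm s r : x / x^-1}.
Proof.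
by move=> x; rewrite /cnorm -prodfV; apply: eq_bigr => i _; rewrite fmorphV.
Qed.

Lemma cnorm_prod s r (I : Type) (q : seq I) (P : pred I) (f : I -> K) :
  cnorm s r (\prod_(i <- q | P i) f i) = \prod_(i <- q | P i) cnorm s r (f i).
Proof.
by rewrite exchange_big /=; apply: eq_bigr => i _; rewrite rmorph_prod.
Qed.

Lemma cnorm_neq0 s r x : x != 0 -> cnorm s r x != 0.
Proof. by move=> nzx; apply/prodf_neq0 => i _; apply: gal_neq0. Qed.

Lemma cnorm_fix s r x : s x = x -> cnorm s r x = x ^+ r.
Proof.
move=> sx; rewrite -[r in RHS]card_ord -prodr_const.
by apply: eq_bigr => i _; rewrite gal_fixX.
Qed.

Lemma gal_cnorm s r x : s (cnorm s r x) * x = cnorm s r x * (s ^+ r)%g x.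
Proof.
elim: r => [|r IHr]; first by rewrite cnorm0 rmorph1 gal_id.
by rewrite cnormS rmorphM mulrAC IHr galXS.
Qed.

Lemma cnorm_fixP s r x :
  x != 0 -> s (cnorm s r x) = cnorm s r x <-> (s ^+ r)%g x = x.
Proof.
move=> nzx; split=> [sN | sx]; last by apply: (mulIf nzx); rewrite gal_cnorm sx.
by apply: (mulfI (cnorm_neq0 s r nzx)); rewrite -gal_cnorm sN.
Qed.

Lemma gal_cnorm_commute s g r x :
  commute s g -> g (cnorm s r x) = cnorm s r (g x).
Proof.
move=> sg; rewrite /cnorm rmorph_prod; apply: eq_bigr => i _.
exact/gal_commute/commute_sym/commuteX/commute_sym.
Qed.

Lemma cnorm_tower s a b x :
  cnorm s (a * b) x = cnorm s a (cnorm (s ^+ a)%g b x).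
Proof.
rewrite mulnC; elim: b => [|b IHb].
  by rewrite !cnorm0 /cnorm big1 // => i _; rewrite rmorph1.
rewrite mulSn addnC cnormS cnormM -IHb /cnorm big_split_ord /=; congr (_ * _).
by apply: eq_bigr => i _; rewrite addnC galXD -expgM mulnC.
Qed.

#[export] Instance cnorm_eq_pow p s r :
  Proper (@eq_pow p K ==> @eq_pow p K) (cnorm s r).
Proof. by move=> x y xy; apply: eq_pow_prod => i _; rewrite xy. Qed.

Lemma Hilbert90_cycle s x :
  cnorm s #[s]%g x = 1 -> exists2 w, w != 0 & x = s w / w.
Proof.
move=> Nx; have gen_s: generator 'Gal({:K} / fixedField <[s]>%g) s.
  by rewrite gal_fixedField; apply: generator_cycle.
have := Hilbert's_theorem_90 gen_s (memvf x^-1).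
rewrite /galNorm gal_fixedField big_cycle -/(cnorm s _ _) cnormV Nx invr1 eqxx.
case/elimT=> // w [_ nzw] xV; exists w => //.
by rewrite -[x]invrK xV invf_div.
Qed.

End GaloisElements.

(** * The group ring acting on power classes *)

Section AugmentationPowers.

Variable p : nat.
Hypothesis p_pr : prime p.

Lemma Xsub1_neq0 i : ('X - 1 : {poly 'F_p}) ^+ i != 0.
Proof. by rewrite expf_neq0 // polyXsubC_eq0. Qed.

Lemma Xsub1_expp k : ('X - 1 : {poly 'F_p}) ^+ (p ^ k) = 'X^(p ^ k) - 1.
Proof.
have pcharX : p \in [pchar {poly 'F_p}] by rewrite pchar_poly pchar_Fp.
elim: k => [|k IHk]; first by rewrite expn0.
by rewrite expnSr exprM IHk exprM -!(pFrobenius_autE pcharX) rmorphB rmorph1.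
Qed.

Lemma Xsub1_geom k j :
  ('X - 1 : {poly 'F_p}) ^+ (p ^ k * (p ^ j).-1) =
    \sum_(i < p ^ j) 'X^(p ^ k) ^+ i.
Proof.
apply: (mulfI (Xsub1_neq0 (p ^ k))); rewrite -exprD -mulnS.
rewrite prednK ?expn_gt0 ?prime_gt0 // -expnD !Xsub1_expp -subrX1 -exprM.
by rewrite expnD.
Qed.

End AugmentationPowers.

Section GroupRingAction.

Variables (p : nat) (F : fieldType) (K : splittingFieldType F).
Hypothesis p_pr : prime p.
Variable s : gal_of {:K}.
Implicit Types (P Q : {poly 'F_p}) (x y : K).

(* x ^ P(s), with the coefficients of P lifted to nat: this is additive and   *)
(* multiplicative in P only up to p-th powers.                                *)
Definition gal_exp P x := \prod_(i < size P) (s ^+ i)%g x ^+ (P`_i)%R.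

Lemma gal_exp_widen n P x : (size P <= n)%N ->
  gal_exp P x = \prod_(i < n) (s ^+ i)%g x ^+ (P`_i)%R.
Proof.
move=> le_n.
rewrite /gal_exp (big_ord_widen n (fun i => (s ^+ i)%g x ^+ (P`_i)%R)) //.
rewrite [LHS]big_mkcond; apply: eq_bigr => i _; case: ltnP => // le_i.
by rewrite nth_default // expr0.
Qed.

Lemma gal_exp_neq0 P x : x != 0 -> gal_exp P x != 0.
Proof.
by move=> nzx; apply/prodf_neq0 => i _; rewrite expf_neq0 ?gal_neq0.
Qed.

#[export] Instance gal_exp_eq_pow P :
  Proper (@eq_pow p K ==> @eq_pow p K) (gal_exp P).
Proof. by move=> x y xy; apply: eq_pow_prod => i _; rewrite xy. Qed.

Lemma gal_exp_prod P (I : Type) (r : seq I) (A : pred I) (f : I -> K) :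
  gal_exp P (\prod_(i <- r | A i) f i) = \prod_(i <- r | A i) gal_exp P (f i).
Proof.
by rewrite exchange_big; apply: eq_bigr => i _; rewrite rmorph_prod -prodrXl.
Qed.

Lemma gal_exp1 P : gal_exp P 1 = 1.
Proof. by rewrite /gal_exp big1 // => i _; rewrite rmorph1 expr1n. Qed.

Lemma cnorm_gal_exp P r x : cnorm s r (gal_exp P x) = gal_exp P (cnorm s r x).
Proof.
rewrite cnorm_prod; apply: eq_bigr => i _; rewrite cnormX.
by rewrite -gal_cnorm_commute //; apply: commuteX.
Qed.

Lemma gal_exp_fixX P r x : s x = x -> gal_exp P (x ^+ r) = gal_exp P x ^+ r.
Proof.
move=> sx; rewrite -prodrXl; apply: eq_bigr => i _.
by rewrite rmorphXn /= -!exprM mulnC.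
Qed.

Lemma gal_exp_fix P x : s x = x -> s (gal_exp P x) = gal_exp P x.
Proof.
by move=> sx; rewrite rmorph_prod; apply: eq_bigr => i _;
  rewrite rmorphXn /= -galXS expgS galM_full sx.
Qed.

Lemma gal_exp_poly0 x : gal_exp 0 x = 1.
Proof. by rewrite /gal_exp size_poly0 big_ord0. Qed.

Lemma gal_exp_polyC c x : gal_exp c%:P x = x ^+ c.
Proof.
by rewrite (@gal_exp_widen 1) ?size_polyC_leq1 // big_ord1 coefC gal_id.
Qed.

Lemma gal_exp_poly1 x : gal_exp 1 x = x.
Proof. by rewrite -polyC1 gal_exp_polyC. Qed.

Lemma gal_exp_polyMX P x : gal_exp (P * 'X) x = s (gal_exp P x).
Proof.
rewrite (@gal_exp_widen (size P).+1); last first.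
  by rewrite (leq_trans (size_polyMleq _ _)) // size_polyX addn2.
rewrite big_ord_recl coefMX /= expr0 mul1r rmorph_prod.
by apply: eq_bigr => i _; rewrite coefMX /= -/(s _) rmorphXn galXS.
Qed.

Lemma gal_exp_polyXn i x : gal_exp 'X^i x = (s ^+ i)%g x.
Proof.
elim: i => [|i IHi]; first by rewrite gal_exp_poly1 gal_id.
by rewrite exprSr gal_exp_polyMX IHi galXS.
Qed.

Lemma gal_exp_polyD P Q x :
  x != 0 -> gal_exp (P + Q) x ~[p] gal_exp P x * gal_exp Q x.
Proof.
move=> nzx; set n := maxn (size P) (size Q).
rewrite !(@gal_exp_widen n) ?leq_maxl ?leq_maxr ?size_polyD // -big_split.
apply: eq_pow_prod => i _; rewrite coefD val_FpD // eq_pow_modn ?gal_neq0 //.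
by rewrite exprD.
Qed.

Lemma gal_exp_polyZ c P x : x != 0 -> gal_exp (c *: P) x ~[p] gal_exp P x ^+ c.
Proof.
move=> nzx; rewrite !(@gal_exp_widen (size P)) ?size_scale_leq // -prodrXl.
apply: eq_pow_prod => i _.
rewrite coefZ mulrC val_FpM // eq_pow_modn ?gal_neq0 //.
by rewrite exprM.
Qed.

Lemma gal_exp_polyB P Q x :
  x != 0 -> gal_exp (P - Q) x ~[p] gal_exp P x / gal_exp Q x.
Proof.
move=> nzx; have : gal_exp P x ~[p] gal_exp (P - Q) x * gal_exp Q x.
  by rewrite -gal_exp_polyD // subrK.
by move=> ->; rewrite mulfK ?gal_exp_neq0.
Qed.

Lemma gal_exp_polyM P Q x :
  x != 0 -> gal_exp (P * Q) x ~[p] gal_exp P (gal_exp Q x).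
Proof.
move=> nzx; have nzQ := gal_exp_neq0 Q nzx.
elim/poly_ind: P => [|P c IHP]; first by rewrite mul0r !gal_exp_poly0.
rewrite mulrDl mulrAC mul_polyC !gal_exp_polyD // gal_exp_polyZ //
  !gal_exp_polyMX.
by rewrite IHP gal_exp_polyC.
Qed.

Lemma gal_exp_polyB1 P x : x != 0 -> gal_exp (P - 1) x ~[p] gal_exp P x / x.
Proof. by move=> nzx; rewrite gal_exp_polyB // gal_exp_poly1. Qed.

Lemma gal_exp_Xsub1 x : x != 0 -> gal_exp ('X - 1) x ~[p] s x / x.
Proof.
by move=> nzx; rewrite gal_exp_polyB1 // -['X]expr1 gal_exp_polyXn expg1.
Qed.

Lemma gal_exp_Xsub1_expp k x :
  x != 0 -> gal_exp (('X - 1) ^+ (p ^ k)) x ~[p] (s ^+ (p ^ k))%g x / x.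
Proof.
by move=> nzx; rewrite Xsub1_expp // gal_exp_polyB1 // gal_exp_polyXn.
Qed.

Lemma galX_expp k x :
  x != 0 -> (s ^+ (p ^ k))%g x ~[p] x * gal_exp (('X - 1) ^+ (p ^ k)) x.
Proof. by move=> nzx; rewrite gal_exp_Xsub1_expp // mulrC divfK. Qed.

Lemma gal_exp_geom e r x :
  x != 0 -> gal_exp (\sum_(i < r) 'X^e ^+ i) x ~[p] cnorm (s ^+ e)%g r x.
Proof.
move=> nzx; elim: r => [|r IHr]; first by rewrite big_ord0 gal_exp_poly0 cnorm0.
by rewrite big_ord_recr cnormS /= gal_exp_polyD // IHr -exprM gal_exp_polyXn
  expgM.
Qed.

Lemma gal_exp_Xsub1_geom k j x : x != 0 ->
  gal_exp (('X - 1) ^+ (p ^ k * (p ^ j).-1)) x ~[p]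
    cnorm (s ^+ (p ^ k))%g (p ^ j) x.
Proof. by move=> nzx; rewrite Xsub1_geom // gal_exp_geom. Qed.

Lemma gal_exp_Xsub1_norm k x :
  x != 0 -> gal_exp (('X - 1) ^+ (p ^ k).-1) x ~[p] cnorm s (p ^ k) x.
Proof.
by move=> nzx; have := gal_exp_Xsub1_geom 0 k nzx; rewrite expn0 mul1n expg1.
Qed.

Lemma gal_exp_dvd_eq1 P Q x :
  x != 0 -> P %| Q -> gal_exp P x ~[p] 1 -> gal_exp Q x ~[p] 1.
Proof.
by move=> nzx /dvdpP[R ->] Px; rewrite gal_exp_polyM // Px gal_exp1.
Qed.

End GroupRingAction.

(** * Lifting the length of a power class *)

Lemma orderX_cofactor (gT : finGroupType) (g : gT) e r :
  (e * r = #[g]%g)%N -> #[(g ^+ e)%g]%g = r.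
Proof.
move=> er; have e_gt0 : (0 < e)%N.
  by have := order_gt0 g; rewrite -er muln_gt0 => /andP[].
by rewrite orderXdiv -er ?dvdn_mulr // mulKn.
Qed.

Lemma prim_root_exp_eq (R : fieldType) (n : nat) (z x y : R) :
    n.-primitive_root z -> y != 0 -> x ^+ n = y ^+ n ->
  exists i : 'I_n, x = z ^+ i * y.
Proof.
move=> prim_z nzy xy; have /(prim_rootP prim_z)[i xE] : (x / y) ^+ n = 1.
  by rewrite expr_div_n xy divff ?expf_neq0.
by exists i; rewrite -xE divfK.
Qed.

(* The factor by which g multiplies x ^+ (r %/ p) * cumul_cnorm g r v, a p-th *)
(* root of cnorm g r x when p %| r and g x = x * v ^+ p, is cnorm g r v.      *)
Definition cumul_cnorm (F : fieldType) (K : splittingFieldType F)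
    (g : gal_of {:K}) (r : nat) (v : K) : K :=
  \prod_(l < r) cnorm g l v.

Section Twists.

Variables (p : nat) (F : fieldType) (K : splittingFieldType F).
Variable g : gal_of {:K}.
Implicit Types (x v f : K).

Lemma cumul_cnorm_neq0 r v : v != 0 -> cumul_cnorm g r v != 0.
Proof. by move=> nzv; apply/prodf_neq0 => l _; apply: cnorm_neq0. Qed.

Lemma gal_cumul_cnorm r v :
  g (cumul_cnorm g r v) * v ^+ r = cumul_cnorm g r v * cnorm g r v.
Proof.
elim: r => [|r IHr]; first by rewrite /cumul_cnorm big_ord0 cnorm0 rmorph1.
rewrite /cumul_cnorm big_ord_recr /= -/(cumul_cnorm g r v) rmorphM exprSr.
by rewrite mulrACA IHr gal_cnorm cnormS mulrACA [_ * (cnorm g r v * _)]mulrCA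
  !mulrA.
Qed.

Lemma galX_twist l x v f : g x = x * (f * v ^+ p) -> g f = f ->
  (g ^+ l)%g x = x * (f ^+ l * cnorm g l v ^+ p) :> K.
Proof.
move=> gx gf; elim: l => [|l IHl]; first by rewrite gal_id cnorm0 expr1n !mulr1.
rewrite galXS IHl !rmorphM !rmorphXn /= gx gf cnormS exprMn.
have := congr1 (fun y => y ^+ p) (gal_cnorm g l v).
by rewrite !exprMn => <-; rewrite exprS; ring.
Qed.

Lemma cnorm_twist r x v f : g x = x * (f * v ^+ p) -> g f = f ->
  cnorm g r x = x ^+ r * (f ^+ 'C(r, 2) * cumul_cnorm g r v ^+ p).
Proof.
move=> gx gf; elim: r => [|r IHr].
  by rewrite cnorm0 /cumul_cnorm big_ord0 expr1n !mulr1.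
rewrite cnormS IHr (galX_twist r gx gf) binS bin1 /cumul_cnorm big_ord_recr.
by rewrite exprD exprMn !exprS; ring.
Qed.

End Twists.

Definition norm_fixed_pow (p : nat) (F : fieldType) (K : splittingFieldType F)
    (s : gal_of {:K}) (x : K) : Prop :=
  exists2 c, s c = c & cnorm s #[s]%g x = c ^+ p.

Definition norm_split (p : nat) (F : fieldType) (K : splittingFieldType F)
    (s : gal_of {:K}) (x : K) : Prop :=
  cnorm s #[s]%g x ~[p] 1 -> norm_fixed_pow p s x.

Section NormFixedPowers.

Variables (p : nat) (F : fieldType) (K : splittingFieldType F).
Variable s : gal_of {:K}.
Hypothesis p_pr : prime p.
Implicit Types (x y : K).
Local Notation fixpN := (norm_fixed_pow p s).

Lemma gal_full_cnorm x : s (cnorm s #[s]%g x) = cnorm s #[s]%g x.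
Proof.
have [-> | nzx] := eqVneq x 0; last first.
  by apply/cnorm_fixP => //; rewrite expg_order gal_id.
by rewrite cnorm_fix ?rmorph0 // rmorphXn /= rmorph0.
Qed.

#[export] Instance norm_fixed_pow_eq_pow : Proper (@eq_pow p K ==> iff) fixpN.
Proof.
suff sub x y : x ~[p] y -> fixpN y -> fixpN x.
  by move=> x y xy; split; apply: sub => //; symmetry.
case=> u nzu -> [c sc Ny]; exists (c * cnorm s #[s]%g u).
  by rewrite rmorphM /= sc gal_full_cnorm.
by rewrite cnormM cnormX Ny exprMn.
Qed.

Lemma norm_fixed_pow1 : fixpN 1.
Proof.
exists 1; first exact: rmorph1.
by rewrite cnorm_fix ?rmorph1 // !expr1n.
Qed.

Lemma norm_fixed_powM x y : fixpN x -> fixpN y -> fixpN (x * y).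
Proof.
move=> [c sc Nx] [d sd Ny]; exists (c * d); first by rewrite rmorphM /= sc sd.
by rewrite cnormM Nx Ny exprMn.
Qed.

Lemma norm_fixed_pow_prod (I : Type) (r : seq I) (f : I -> K) :
  (forall i, fixpN (f i)) -> fixpN (\prod_(i <- r) f i).
Proof.
by move=> fP; elim/big_ind: _ => //;
  [apply: norm_fixed_pow1 | apply: norm_fixed_powM].
Qed.

Lemma norm_fixed_pow_gal_exp (P : {poly 'F_p}) x :
  fixpN x -> fixpN (gal_exp s P x).
Proof.
case=> c sc Nx; exists (gal_exp s P c); first exact: gal_exp_fix.
by rewrite cnorm_gal_exp Nx gal_exp_fixX.
Qed.

Lemma norm_fixed_pow_coboundary x : x != 0 -> fixpN (s x / x).
Proof.
move=> nzx; exists 1; first exact: rmorph1.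
rewrite cnormM cnormV -gal_cnorm_commute // gal_full_cnorm.
by rewrite mulfV ?cnorm_neq0 // expr1n.
Qed.

Lemma norm_fixed_pow_subfield e r x :
  (e * r = #[s]%g)%N -> (p %| r)%N -> (s ^+ e)%g x = x -> fixpN x.
Proof.
move=> er /dvdnP[m rE] sx; have [-> | nzx] := eqVneq x 0.
  exists 0; rewrite ?rmorph0 // cnorm_fix ?rmorph0 // !expr0n.
  by rewrite gtn_eqF ?order_gt0 // gtn_eqF ?prime_gt0.
exists (cnorm s e x ^+ m).
  by rewrite rmorphXn /= (iffRL (cnorm_fixP s e nzx)).
by rewrite -er cnorm_tower (cnorm_fix _ sx) cnormX rE exprM.
Qed.

End NormFixedPowers.

Section NormDescent.

Variables (p : nat) (F : fieldType) (K : splittingFieldType F).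
Variables (s : gal_of {:K}) (z : K).
Hypotheses (p_pr : prime p) (prim_z : p.-primitive_root z) (fix_z : s z = z).
Implicit Types (x y f t v w a : K) (g h : gal_of {:K}).

Let p_gt0 : (0 < p)%N := prime_gt0 p_pr.

Lemma gal_fix_pth_root x c : s c = c -> x ^+ p = c ^+ p -> s x = x.
Proof.
move=> sc xc; have [c0 | nzc] := eqVneq c 0.
  move/eqP: xc; rewrite c0 expr0n gtn_eqF // expf_eq0 p_gt0 => /eqP->.
  by rewrite rmorph0.
have [i ->] := prim_root_exp_eq prim_z nzc xc.
by rewrite rmorphM rmorphXn /= fix_z sc.
Qed.

(* Let c be the p-th root of the norm of x given by cumul_cnorm. Its norm     *)
(* down to the fixed field of s, multiplied by a, is a p-th root of b ^+ p    *)
(* with s b = b, hence is fixed by s; so c is fixed by s ^+ e.                *)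
Lemma norm_fixed_pow_twist e r x f v a :
    (e * r = #[s]%g)%N -> (p %| r)%N -> x != 0 -> v != 0 ->
    s f = f -> f != 0 -> s a = a -> f ^+ (e * 'C(r, 2)) = a ^+ p ->
    norm_fixed_pow p s x -> (s ^+ e)%g x = x * (f * v ^+ p) ->
  f ^+ (r %/ p) * cnorm (s ^+ e)%g r v = 1.
Proof.
move=> er p_r nzx nzv sf nzf sa fa [b sb Nx]; set g := (s ^+ e)%g => gx.
have gf : g f = f := gal_fixX e sf.
pose c := x ^+ (r %/ p) * cumul_cnorm g r v.
have nzc : c != 0 by rewrite mulf_neq0 ?expf_neq0 ?cumul_cnorm_neq0.
have gc : g c = c * (f ^+ (r %/ p) * cnorm g r v).
  apply: (mulIf (expf_neq0 r nzv)); rewrite rmorphM rmorphXn /= -mulrA.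
  rewrite gal_cumul_cnorm gx !exprMn -exprM [(p * _)%N]mulnC divnK // /c.
  by ring.
have Nf : cnorm s e (f ^+ 'C(r, 2)) = a ^+ p.
  by rewrite cnormX (cnorm_fix e sf) -exprM fa.
have Nc : (cnorm s e c * a) ^+ p = b ^+ p.
  rewrite -Nx -er cnorm_tower (cnorm_twist r gx gf) exprMn -Nf -cnormX -cnormM.
  by rewrite /c exprMn -exprM divnK //; congr cnorm; ring.
have nza : a != 0.
  by apply: contraTneq (expf_neq0 (e * 'C(r, 2)) nzf) => a0;
    rewrite fa a0 expr0n gtn_eqF ?eqxx.
have sN : s (cnorm s e c) = cnorm s e c.
  apply: (mulIf nza); rewrite -{1}sa -rmorphM.
  exact: gal_fix_pth_root sb Nc.
apply: (mulfI nzc); rewrite -gc mulr1.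
exact/(cnorm_fixP s e nzc).
Qed.

Lemma eq_pow_gal_fixed e r x :
    (e * r = #[s]%g)%N -> (p %| r)%N -> x != 0 -> norm_fixed_pow p s x ->
    (s ^+ e)%g x ~[p] x ->
  exists2 y, y ~[p] x & (s ^+ e)%g y = y.
Proof.
move=> er p_r nzx Nx [v nzv gx].
have := norm_fixed_pow_twist (f := 1) (a := 1) er p_r nzx nzv.
rewrite !rmorph1 !expr1n !mul1r oner_eq0 => /(_ _ _ _ _ Nx gx) Nv.
have [|w nzw vE] := @Hilbert90_cycle _ _ (s ^+ e)%g v;
  first by rewrite (orderX_cofactor er) Nv.
exists (x * w^-1 ^+ p); first by rewrite eq_pow_mul_exp ?invr_eq0.
rewrite rmorphM rmorphXn fmorphV /= gx vE expr_div_n -mulrA mulrAC !exprVn.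
by rewrite mulfV ?mul1r // expf_neq0 ?gal_neq0.
Qed.

Lemma twist_is_cnorm_top e x f t :
    (e * p = #[s]%g)%N -> (p %| e * 'C(p, 2))%N -> x != 0 -> t != 0 ->
    s f = f -> f != 0 -> norm_fixed_pow p s x ->
    (s ^+ e)%g x = x * (f * t ^+ p) ->
  exists2 y, y != 0 & cnorm (s ^+ e)%g p y = f.
Proof.
move=> ep /dvdnP[m mE] nzx nzt sf nzf Nx gx.
have sfm : s (f ^+ m) = f ^+ m by rewrite rmorphXn /= sf.
have := norm_fixed_pow_twist ep (dvdnn p) nzx nzt sf nzf sfm _ Nx gx.
rewrite mE exprM divnn p_gt0 expr1 => /(_ erefl) fNt.
exists t^-1; first by rewrite invr_eq0.
by rewrite cnormV -[LHS]mul1r -fNt mulfK ?cnorm_neq0.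
Qed.

(* f * cnorm h p t is a p-th root of unity; as p divides the order of h ^+ p, *)
(* there is b with (h ^+ p) b = z * b, and a power of b absorbs that root.    *)
Lemma twist_is_cnorm h x f t :
    h z = z -> (p %| #[(h ^+ p)%g]%g)%N -> x != 0 -> t != 0 -> h f = f ->
    (h ^+ p)%g x = x -> h x = x * (f * t ^+ p) ->
  exists2 y, y != 0 & cnorm h p y = f.
Proof.
move=> hz p_ord nzx nzt hf hpx hx.
have /(prim_rootP prim_z)[i tE] : (f * cnorm h p t) ^+ p = 1.
  by rewrite exprMn; apply: (mulfI nzx);
    rewrite -(galX_twist p hx hf) hpx mulr1.
have Nz : cnorm (h ^+ p)%g #[(h ^+ p)%g]%g z = 1.
  rewrite cnorm_fix ?gal_fixX //.
  by case/dvdnP: p_ord => m ->;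
    rewrite mulnC exprM (prim_expr_order prim_z) expr1n.
have [b nzb zE] := Hilbert90_cycle Nz.
pose u := b ^+ (p - i).
have nzu : u != 0 by rewrite expf_neq0.
have Nu : cnorm h p (h u / u) = z ^+ (p - i).
  have nzN := cnorm_neq0 h p nzu; rewrite cnormM cnormV -gal_cnorm_commute //.
  apply: (mulIf nzu); rewrite mulrAC gal_cnorm mulrAC mulfV // mul1r.
  by rewrite /u rmorphXn /= -exprMn zE divfK.
pose y := t * (h u / u).
have nzy : y != 0 by rewrite !mulf_neq0 ?invr_eq0 ?gal_neq0.
exists y^-1; first by rewrite invr_eq0.
rewrite cnormV; apply: (mulIf (cnorm_neq0 h p nzy)).
rewrite mulVf ?cnorm_neq0 // /y cnormM mulrA tE Nu -exprD.
by rewrite subnKC ?(prim_expr_order prim_z) // ltnW.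
Qed.

Lemma cnorm_fixed_coboundary e y : (e * p %| #[s]%g)%N -> y != 0 ->
    s (cnorm (s ^+ e)%g p y) = cnorm (s ^+ e)%g p y ->
  exists w, [/\ w != 0, (s ^+ (e * p))%g w = w & (s ^+ e)%g w / w = s y / y].
Proof.
case/dvdnP=> r /esym er nzy; set h := (s ^+ e)%g => sN.
have hs : commute s h by apply: commuteX.
have nzN := cnorm_neq0 h p nzy.
have Nsy : cnorm h p (s y / y) = 1.
  by rewrite cnormM cnormV -gal_cnorm_commute ?sN ?mulfV //; apply: commute_sym.
have hpy : (h ^+ p)%g y = y by apply/cnorm_fixP; rewrite // gal_fixX.
have hpsy : (h ^+ p)%g (s y / y) = s y / y.
  rewrite rmorphM fmorphV /= hpy; congr (_ / _).
  by rewrite gal_commute ?hpy //; apply: commuteX.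
have ord_h : #[h]%g = (p * r)%N by apply: orderX_cofactor; rewrite mulnA mulnC.
have [|w nzw wE] := @Hilbert90_cycle _ _ h (s y / y).
  by rewrite ord_h cnorm_tower (cnorm_fix _ hpsy) cnormX Nsy expr1n.
exists w; split=> //; rewrite expgM -/h.
apply/(cnorm_fixP h p nzw); move: Nsy.
rewrite wE cnormM cnormV -gal_cnorm_commute // => /divr1_eq; exact.
Qed.

End NormDescent.

Lemma expn_up_log_bounds (p n i : nat) :
  prime p -> (0 < i <= p ^ n)%N -> (0 < p ^ up_log p i <= p ^ n)%N.
Proof.
move=> p_pr /andP[_ le_i]; have p_gt1 := prime_gt1 p_pr.
by rewrite expn_gt0 prime_gt0 // leq_exp2l // up_log_min.
Qed.

Section LengthLift.

Variables (p n : nat) (F : fieldType) (K : splittingFieldType F).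
Variables (s : gal_of {:K}) (z : K).
Hypotheses (p_pr : prime p) (prim_z : p.-primitive_root z) (fix_z : s z = z).
Hypothesis ord_s : #[s]%g = (p ^ n)%N.
Implicit Types (x y f : K).
Local Notation U := ('X - 1 : {poly 'F_p}).

Let p_gt0 : (0 < p)%N := prime_gt0 p_pr.

Lemma expn_cofactor k : (k <= n)%N -> (p ^ k * p ^ (n - k) = #[s]%g)%N.
Proof. by move=> le_kn; rewrite -expnD subnKC. Qed.

(* This fails for p ^ n = 2: take F = Q, K = Q(i), x = 1 and f = -1.          *)
Lemma fixed_is_cnorm k x f : (k < n)%N -> (2 < p ^ n)%N -> x != 0 -> f != 0 ->
    s f = f -> norm_fixed_pow p s x ->
    (s ^+ (p ^ k))%g x ~[p] x * f -> (s ^+ (p ^ k.+1))%g x ~[p] x ->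
  exists2 y, y != 0 & cnorm (s ^+ (p ^ k))%g p y = f.
Proof.
move=> lt_kn pn_gt2 nzx nzf sf Nx hx gx; set h := (s ^+ (p ^ k))%g in hx *.
have hp : (h ^+ p = s ^+ (p ^ k.+1))%g by rewrite -expgM expnSr.
case: (ltngtP k.+1 n) lt_kn => // [lt_k1n _ | k1n _].
  have p_dvd : (p %| p ^ (n - k.+1))%N.
    by rewrite -(subnSK lt_k1n) expnS dvdn_mulr.
  have [y yx gy] :=
    eq_pow_gal_fixed p_pr prim_z fix_z (expn_cofactor (ltnW lt_k1n))
    p_dvd nzx Nx gx.
  have nzy : y != 0 by rewrite (eq_pow_neq0 yx).
  have [t nzt hy] : h y ~[p] y * f by rewrite yx.
  apply: (twist_is_cnorm prim_z (gal_fixX _ fix_z) _ nzy nzt (gal_fixX _ sf)).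
  - by rewrite -/h hp (orderX_cofactor (expn_cofactor (ltnW lt_k1n))).
  - by rewrite -/h hp.
  - by rewrite mulrA.
have [t nzt {}hx] := hx.
rewrite -mulrA in hx.
apply: (twist_is_cnorm_top p_pr prim_z fix_z _ _ nzx nzt sf nzf Nx hx).
  by rewrite ord_s -k1n expnSr.
have [p2|p_neq2] := eqVneq p 2%N; last first.
  rewrite dvdn_mull // prime_dvd_bin //= ltn_neqAle eq_sym p_neq2.
  exact: prime_gt1.
case: k k1n {h hx hp gx} => [|k] k1n; last by rewrite expnS -mulnA dvdn_mulr.
by rewrite -k1n p2 in pn_gt2.
Qed.

Lemma cnorm_fixed_lift k y : (k < n)%N -> y != 0 ->
    s (cnorm (s ^+ (p ^ k))%g p y) = cnorm (s ^+ (p ^ k))%g p y ->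
  exists w, [/\ w != 0, (s ^+ (p ^ k.+1))%g w = w
    & gal_exp s (U ^+ (p ^ k.+1).-1) w ~[p] cnorm (s ^+ (p ^ k))%g p y].
Proof.
move=> lt_kn nzy sN; have p_dvd : (p ^ k * p %| #[s]%g)%N.
  by rewrite -expnSr ord_s dvdn_exp2l.
have [w [nzw gw wE]] := cnorm_fixed_coboundary p_dvd nzy sN.
rewrite -expnSr in gw; exists w; split=> //.
have q_gt0 : (0 < p ^ k)%N by rewrite expn_gt0 p_gt0.
have -> : ((p ^ k.+1).-1 = (p ^ k * p.-1).-1 + p ^ k)%N.
  have := prime_gt1 p_pr; rewrite expnSr; case: (p) => [|[|m]] //= _; nia.
rewrite exprD gal_exp_polyM // gal_exp_Xsub1_expp // wE -gal_exp_Xsub1 //.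
rewrite -gal_exp_polyM // -exprSr prednK;
  last by rewrite muln_gt0 q_gt0 -subn1 subn_gt0 prime_gt1.
by have := gal_exp_Xsub1_geom p_pr s k 1 nzy; rewrite expn1.
Qed.

Lemma norm_split_short i x : (i < p ^ n)%N -> x != 0 ->
  gal_exp s (U ^+ i) x ~[p] 1 -> norm_split p s x -> norm_fixed_pow p s x.
Proof.
move=> lt_i nzx Ui; apply; rewrite ord_s -(gal_exp_Xsub1_norm p_pr) //.
apply: gal_exp_dvd_eq1 Ui => //; rewrite dvdp_exp2l // -ltnS.
by rewrite prednK ?expn_gt0 ?p_gt0.
Qed.

Lemma exists_fixed_rep x : (0 < n)%N -> x != 0 -> norm_fixed_pow p s x ->
  gal_exp s U x ~[p] 1 -> exists2 f, f ~[p] x & s f = f.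
Proof.
move=> n_gt0 nzx Nx Ux.
have [||f fx sf] := eq_pow_gal_fixed p_pr prim_z fix_z (mul1n _) _ nzx Nx.
- by rewrite ord_s dvdn_exp.
- by rewrite -[1%N](expn0 p) galX_expp // expr1 Ux mulr1.
by exists f.
Qed.

Lemma length_lift_expp k i x : (k < n)%N -> (p ^ k < i < p ^ k.+1)%N ->
    x != 0 -> gal_exp s (U ^+ i) x ~[p] 1 -> norm_fixed_pow p s x ->
  exists w, [/\ w != 0, (s ^+ (p ^ k.+1))%g w = w
    & gal_exp s (U ^+ (p ^ k.+1).-1) w ~[p] gal_exp s (U ^+ i.-1) x].
Proof.
move=> lt_kn /andP[gt_i lt_i] nzx Ui Nx.
have pk_gt0 : (0 < p ^ k)%N by rewrite expn_gt0 p_gt0.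
have i_gt0 : (0 < i)%N by apply: leq_trans gt_i.
have le_k1n : (p ^ k.+1 <= p ^ n)%N by rewrite leq_exp2l ?prime_gt1.
have n_gt0 : (0 < n)%N by apply: leq_trans lt_kn.
have nzUx := gal_exp_neq0 s (U ^+ i.-1) nzx.
have [|f fE sf] := exists_fixed_rep n_gt0 nzUx (norm_fixed_pow_gal_exp _ Nx).
  by rewrite -gal_exp_polyM // -exprS prednK.
have nzf : f != 0 by rewrite (eq_pow_neq0 fE).
pose x0 := gal_exp s (U ^+ (i.-1 - p ^ k)) x.
have nzx0 : x0 != 0 by apply: gal_exp_neq0.
have [|||y nzy Ny] := @fixed_is_cnorm k x0 f lt_kn _ nzx0 nzf sf
  (norm_fixed_pow_gal_exp _ Nx).
- by apply: leq_trans le_k1n; lia.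
- rewrite fE galX_expp // -gal_exp_polyM // -exprD subnKC //.
  by rewrite -ltnS prednK.
- rewrite galX_expp // -gal_exp_polyM // -exprD.
  rewrite (gal_exp_dvd_eq1 _ _ _ Ui) ?mulr1 //.
  by rewrite dvdp_exp2l // (leq_trans (ltnW lt_i)) ?leq_addr.
rewrite -Ny in sf; have [w [nzw gw Uw]] := cnorm_fixed_lift lt_kn nzy sf.
by exists w; split=> //; rewrite Uw Ny.
Qed.

Lemma length_lift i x : (0 < i <= p ^ n)%N -> x != 0 ->
    gal_exp s (U ^+ i) x ~[p] 1 -> ~ gal_exp s (U ^+ i.-1) x ~[p] 1 ->
    norm_split p s x ->
  exists y, [/\ y != 0, norm_split p s y
    & gal_exp s (U ^+ (p ^ up_log p i).-1) y ~[p] gal_exp s (U ^+ i.-1) x].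
Proof.
case/andP=> i_gt0 le_i nzx Ui Ui1 Nx; have p_gt1 := prime_gt1 p_pr.
have [iE | neq_i] := eqVneq i (p ^ up_log p i)%N.
  by exists x; rewrite -iE.
have i_gt1 : (1 < i)%N.
  by case: i i_gt0 neq_i {le_i Ui Ui1} => [|[]]; rewrite ?up_log1.
have [k kE] : exists k, up_log p i = k.+1.
  by exists (up_log p i).-1; rewrite prednK // up_log_gt0 p_gt1.
have /andP[gt_i le_ik] := up_log_bounds p_gt1 i_gt1.
rewrite kE /= in gt_i le_ik neq_i *.
have lt_i : (i < p ^ k.+1)%N by rewrite ltn_neqAle neq_i.
have lt_kn : (k < n)%N by rewrite -kE up_log_min.
have {}Nx : norm_fixed_pow p s x.
  apply: norm_split_short Ui Nx => //; apply: leq_trans lt_i _.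
  by rewrite leq_exp2l.
have [|w [nzw gw Uw]] := length_lift_expp lt_kn _ nzx Ui Nx.
  by rewrite gt_i.
exists w; split=> //.
case: (ltngtP k.+1 n) lt_kn => // [lt_k1n _ _ | k1n _].
  apply: (norm_fixed_pow_subfield p_pr (expn_cofactor (ltnW lt_k1n))) gw.
  by rewrite -(subnSK lt_k1n) expnS dvdn_mulr.
by rewrite /norm_split ord_s -k1n -gal_exp_Xsub1_norm // Uw => /Ui1.
Qed.

End LengthLift.

(** * Decomposition into cyclic modules *)

Definition ffun_single (I : finType) (V : nmodType) (j : I) (v : V) :
  {ffun I -> V} :=
  [ffun i => if i == j then v else 0].

Lemma ffun_sum_single (I : finType) (V : nmodType) (f : {ffun I -> V}) :
  f = \sum_j ffun_single j (f j).
Proof.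
apply/ffunP=> i; rewrite sum_ffunE (bigD1 i) //= big1 => [|j /negPf neq_ji].
  by rewrite ffunE eqxx addr0.
by rewrite ffunE eq_sym neq_ji.
Qed.

(* pi induces an isomorphism from the sum of the k[X] / (d j) onto the column *)
(* space on which X acts as R.                                                *)
Record presentation (k : fieldType) (m : nat) (R : 'M[k]_m) (I : finType)
    (d : I -> {poly k}) (pi : {ffun I -> {poly k}} -> 'cV[k]_m) : Prop :=
  Presentation {
    pres_linear : linear pi;
    pres_mulX : forall P : {ffun I -> {poly k}},
      pi [ffun j => P j * 'X] = R *m pi P;
    pres_surj : forall v, exists P, pi P = v;
    pres_eq0 : forall P, pi P = 0 <-> forall j, d j %| P j
  }.

Definition decomposes (k : fieldType) (m : nat) (R : 'M[k]_m) (I : finType)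
  (d : I -> {poly k}) : Prop := exists pi, presentation R d pi.

Section PresentationTheory.

Variables (k : fieldType) (m : nat) (R : 'M[k]_m).
Variables (I : finType) (d : I -> {poly k}).
Variable pi : {ffun I -> {poly k}} -> 'cV[k]_m.
Hypothesis pres_pi : presentation R d pi.

Lemma presD : {morph pi : P Q / P + Q}.
Proof. by move=> P Q; have := pres_linear pres_pi 1 P Q; rewrite !scale1r. Qed.

Lemma pres0 : pi 0 = 0.
Proof. by apply/(pres_eq0 pres_pi) => j; rewrite ffunE dvdp0. Qed.

Definition pres_gen (j : I) (P : {poly k}) : 'cV[k]_m := pi (ffun_single j P).

Lemma pres_gen_linear j : linear (pres_gen j).
Proof.
move=> c P Q; rewrite -(pres_linear pres_pi); congr pi; apply/ffunP=> i.
by rewrite !ffunE; case: eqP => // _; rewrite scaler0 addr0.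
Qed.

Lemma pres_gen_mulX j P : pres_gen j (P * 'X) = R *m pres_gen j P.
Proof.
rewrite -(pres_mulX pres_pi); congr pi; apply/ffunP=> i.
by rewrite !ffunE; case: eqP; rewrite ?mul0r.
Qed.

Lemma pres_gen0 j : pres_gen j 0 = 0.
Proof.
by rewrite -pres0; congr pi; apply/ffunP=> i; rewrite !ffunE if_same.
Qed.

Lemma sum_pres_gen (P : {ffun I -> {poly k}}) : \sum_j pres_gen j (P j) = pi P.
Proof. by rewrite -(big_morph pi presD pres0) -ffun_sum_single. Qed.

End PresentationTheory.

Section Decompositions.

Variable k : fieldType.

Lemma decomposes_void (R : 'M[k]_0) (d : void -> {poly k}) : decomposes R d.
Proof.
exists (fun=> 0); split=> [c u v | P | v | P].
- by rewrite scaler0 addr0.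
- by rewrite mulmx0.
- by exists 0; rewrite [RHS]flatmx0.
- by split=> // _ [].
Qed.

Lemma decomposes_dsum m1 m2 (R1 : 'M[k]_m1) (R2 : 'M[k]_m2) (I1 I2 : finType)
    (d : I1 + I2 -> {poly k}) :
    decomposes R1 (fun j => d (inl j)) -> decomposes R2 (fun j => d (inr j)) ->
  decomposes (block_mx R1 0 0 R2) d.
Proof.
case=> [pi1 [lin1 X1 surj1 ker1]] [pi2 [lin2 X2 surj2 ker2]].
pose lpart (P : {ffun I1 + I2 -> {poly k}}) := [ffun j => P (inl j)].
pose rpart (P : {ffun I1 + I2 -> {poly k}}) := [ffun j => P (inr j)].
exists (fun P => col_mx (pi1 (lpart P)) (pi2 (rpart P)));
  split=> [c P Q | P | v | P].
- rewrite scale_col_mx add_col_mx -lin1 -lin2; congr col_mx; congr (_ _);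
  by apply/ffunP=> j; rewrite !ffunE.
- rewrite mul_block_col !mul0mx addr0 add0r -X1 -X2; congr col_mx; congr (_ _);
  by apply/ffunP=> j; rewrite !ffunE.
- have [P1 P1v] := surj1 (usubmx v); have [P2 P2v] := surj2 (dsubmx v).
  exists [ffun j => match j with inl j1 => P1 j1 | inr j2 => P2 j2 end].
  rewrite -[RHS]vsubmxK -P1v -P2v; congr col_mx; congr (_ _);
  by apply/ffunP=> j; rewrite !ffunE.
- rewrite -[0]col_mx0; split=> [/eq_col_mx[/ker1 P1 /ker2 P2] | dP].
    by case=> j; [have := P1 j | have := P2 j]; rewrite ffunE.
  by congr col_mx; [apply/ker1 | apply/ker2] => j; rewrite ffunE.
Qed.

Lemma decomposes_sim m1 m2 (R1 : 'M[k]_m1) (R2 : 'M[k]_m2) B (I : finType)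
    (d : I -> {poly k}) :
    m1 = m2 -> row_free B -> R1 *m B = B *m R2 ->
  decomposes R2 d -> decomposes R1 d.
Proof.
move=> m12; case: _ / m12 in R2 B * => freeB RB.
case=> pi [lin_pi X_pi surj_pi ker_pi].
have unitB : B \in unitmx by rewrite -row_free_unit.
exists (fun P => B *m pi P); split=> [c P Q | P | v | P].
- by rewrite lin_pi mulmxDr scalemxAr.
- by rewrite X_pi !mulmxA RB.
- by have [P Pv] := surj_pi (invmx B *m v); exists P; rewrite Pv mulKVmx.
- by rewrite -ker_pi; split=> [/(canRL (mulKmx unitB))-> | ->]; rewrite mulmx0.
Qed.

Lemma nilpotent_chain_free m (U : 'M[k]_m) (w : 'rV_m) e :
    w *m U ^+ e = 0 -> w *m U ^+ e.-1 != 0 ->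
  row_free (\matrix_(i < e) (w *m U ^+ i)).
Proof.
move=> we we1; apply: inj_row_free => c; rewrite mulmx_sum_row => c0.
apply/rowP=> i; rewrite mxE; have [n le_in] := ubnP (i : nat).
elim: n => // n IHn in i le_in *.
have lt_c (j : 'I_e) : (j < i)%N -> c 0 j = 0.
  by move=> lt_ji; apply: IHn; apply: leq_trans lt_ji _; rewrite -ltnS.
have := congr1 (fun v => v *m U ^+ (e.-1 - i)) c0.
rewrite mul0mx mulmx_suml (bigD1 i) //= big1 => [|j neq_ji].
  rewrite addr0 rowK -scalemxAl -mulmxA mulmxE -exprD subnKC; last first.
    by rewrite -ltnS (ltn_predK (ltn_ord i)).
  by move/eqP; rewrite scalemx_eq0 (negPf we1) orbF => /eqP.
rewrite rowK -scalemxAl; case: (ltngtP j i) => [/lt_c-> | lt_ij | /val_inj ji].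
- by rewrite scale0r.
- rewrite -mulmxA mulmxE -exprD.
  have -> : (j + (e.-1 - i) = e + (j - i.+1))%N.
    have := ltn_ord j; have := ltn_ord i; lia.
  by rewrite exprD -mulmxE mulmxA we mul0mx scaler0.
- by rewrite ji eqxx in neq_ji.
Qed.

Lemma nilpotent_chain_eq0 m (U : 'M[k]_m) (w : 'rV_m) :
  w *m U ^+ m = 0 -> w *m U ^+ m.-1 != 0 -> U ^+ m = 0.
Proof.
move=> wm wm1; pose W := \matrix_(i < m) (w *m U ^+ i).
have unitW : W \in unitmx by rewrite -row_free_unit nilpotent_chain_free.
apply: (can_inj (mulKmx unitW)); rewrite mulmx0; apply/row_matrixP=> i.
rewrite row_mul rowK row0 -mulmxA mulmxE -exprD addnC exprD -mulmxE mulmxA.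
by rewrite wm mul0mx.
Qed.

Section JordanBlock.

Variables (m : nat) (R : 'M[k]_m.+1) (a : k) (f : 'cV[k]_m.+1).
Local Notation U := (R - a%:M).
Hypotheses (nilU : U ^+ m.+1 = 0) (nzUf : U ^+ m *m f != 0).

Lemma horner_mx_XsubC_exp i : horner_mx R (('X - a%:P) ^+ i) = U ^+ i.
Proof. by rewrite rmorphXn rmorphB /= horner_mx_X horner_mx_C. Qed.

Lemma horner_mxM P Q : horner_mx R (P * Q) = horner_mx R P *m horner_mx R Q.
Proof. exact: rmorphM. Qed.

Lemma horner_mx_col_eq0 P :
  horner_mx R P *m f = 0 <-> ('X - a%:P) ^+ m.+1 %| P.
Proof.
split=> [Pf | /dvdpP[Q ->]]; last first.
  by rewrite horner_mxM horner_mx_XsubC_exp nilU mulmx0 mul0mx.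
have [-> | nzP] := eqVneq P 0; first exact: dvdp0.
have [i [Q Qa PE]] := multiplicity_XsubC P a; rewrite nzP /= in Qa.
have [lt_mi | le_im] := ltnP m i; first by rewrite PE dvdp_mull ?dvdp_exp2l.
have /Bezout_eq1_coprimepP[[A B] /= AB] : coprimep Q (('X - a%:P) ^+ m.+1).
  by apply: coprimep_expr; rewrite coprimep_XsubC.
have XE : ('X - a%:P) ^+ m =
    A * ('X - a%:P) ^+ (m - i) * P + B * ('X - a%:P) ^+ m * ('X - a%:P) ^+ m.+1.
  by rewrite -[LHS]mul1r -AB mulrDl -{1}(subnK le_im) exprD PE; ring.
move/eqP: nzUf; case; rewrite -horner_mx_XsubC_exp XE rmorphD mulmxDl /=.
rewrite (horner_mxM _ P) -mulmxA Pf mulmx0 add0r.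
by rewrite horner_mxM horner_mx_XsubC_exp nilU mulmx0 mul0mx.
Qed.

Lemma horner_mx_rVpoly_powers (c : 'rV_m.+1) :
  c *m (\matrix_(i < m.+1) (R ^+ i *m f)^T) = (horner_mx R (rVpoly c) *m f)^T.
Proof.
rewrite mulmx_sum_row /rVpoly poly_def rmorph_sum mulmx_suml linear_sum /=.
apply: eq_bigr => i _; rewrite rowK linearZ /= rmorphXn /= horner_mx_X valK.
by rewrite -scalemxAl linearZ.
Qed.

Lemma horner_mx_col_surj v : exists P, horner_mx R P *m f = v.
Proof.
pose M := \matrix_(i < m.+1) (R ^+ i *m f)^T.
have unitM : M \in unitmx.
  rewrite -row_free_unit; apply: inj_row_free => c;
    rewrite horner_mx_rVpoly_powers.
  move/eqP; rewrite trmx_eq0 => /eqP/horner_mx_col_eq0 /dvdp_leq.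
  rewrite size_exp_XsubC ltnNge size_poly.
  case: eqVneq => [c0 _ | _ /(_ isT)] //.
  by rewrite -[c]rVpolyK c0 linear0.
exists (rVpoly (v^T *m invmx M)).
by apply: trmx_inj; rewrite -horner_mx_rVpoly_powers mulmxKV.
Qed.

Lemma decomposes_horner_col :
  decomposes R (fun _ : unit => ('X - a%:P) ^+ m.+1).
Proof.
exists (fun P => horner_mx R (P tt) *m f); split=> [c P Q | P | v | P].
- by rewrite !ffunE linearP mulmxDl -scalemxAl.
- by rewrite ffunE mulrC horner_mxM horner_mx_X mulmxA.
- by have [P Pv] := horner_mx_col_surj v; exists [ffun=> P]; rewrite ffunE.
- by rewrite horner_mx_col_eq0; split=> [dP [] | ].
Qed.

End JordanBlock.

Lemma decomposes_jordan_block m (R : 'M[k]_m) (a : k) (w : 'rV_m) e :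
    m = e -> w *m (R - a%:M) ^+ e = 0 -> w *m (R - a%:M) ^+ e.-1 != 0 ->
  decomposes R (fun _ : unit => ('X - a%:P) ^+ e).
Proof.
move=> <- we we1; case: m => [|m] in R w we we1 *;
  first by rewrite [w *m _]thinmx0 eqxx in we1.
have nilU := nilpotent_chain_eq0 we we1.
have [j nzUj] : exists j, (R - a%:M) ^+ m *m delta_mx j (0 : 'I_1) != 0.
  apply/existsP; apply: contraNT we1 => /existsPn U0.
  have -> : (R - a%:M) ^+ m = 0; last by rewrite mulmx0.
  apply/matrixP => i j; have := U0 j; rewrite negbK -colE => /eqP/colP/(_ i).
  by rewrite !mxE.
exact: decomposes_horner_col nilU nzUj.
Qed.

End Decompositions.

Section CyclicModules.

Variables (p n : nat) (gT : finGroupType) (s : gT).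
Hypotheses (p_pr : prime p) (ord_s : #[s]%g = (p ^ n)%N).
Local Notation aG := (regular_repr 'F_p <[s]>%g).
Local Notation U := (aG s - 1%:M).

Lemma mx_sub1_expp m (R : 'M['F_p]_m) k :
  (R - 1%:M) ^+ (p ^ k) = R ^+ (p ^ k) - 1%:M.
Proof.
case: m R => [|m] R; first by rewrite [LHS]thinmx0 [RHS]thinmx0.
rewrite -horner_mx_XsubC_exp Xsub1_expp //.
by rewrite rmorphB rmorphXn rmorph1 /= horner_mx_X.
Qed.

Lemma mx_sub1_norm m (R : 'M['F_p]_m) k :
  (R - 1%:M) ^+ (p ^ k).-1 = \sum_(i < p ^ k) R ^+ i.
Proof.
case: m R => [|m] R; first by rewrite [LHS]thinmx0 [RHS]thinmx0.
rewrite -horner_mx_XsubC_exp -[(p ^ k).-1]mul1n -[in LHS](expn0 p).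
rewrite Xsub1_geom //.
by rewrite rmorph_sum; apply: eq_bigr => i _;
  rewrite expn0 !rmorphXn /= horner_mx_X.
Qed.

Lemma repr_mx_cycleX m (rG : mx_representation 'F_p <[s]> m) i :
  rG (s ^+ i)%g = rG s ^+ i.
Proof.
elim: i => [|i IHi]; first by rewrite repr_mx1.
by rewrite expgSr repr_mxM ?mem_cycle ?cycle_id // IHi exprSr mulmxE.
Qed.

Lemma aug_powD i j : aug_pow p s (i + j) = aug_pow p s i *m U ^+ j.
Proof. by rewrite /aug_pow exprD -mulmxE gring_row_mul. Qed.

Lemma aug_pow_order : aug_pow p s (p ^ n) = 0.
Proof.
rewrite /aug_pow mx_sub1_expp -repr_mx_cycleX -ord_s expg_order repr_mx1.
by rewrite subrr linear0.
Qed.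

Lemma aug_pow_order_pred : aug_pow p s (p ^ n).-1 != 0.
Proof.
apply/eqP; rewrite /aug_pow mx_sub1_norm => normE.
have := congr1 (fun u => row (gring_index <[s]>%G 1%g) u^T) normE.
rewrite trmx0 row0 -[LHS]/(gring_proj 1%g _) linear_sum.
rewrite (eq_bigr (fun i : 'I_(p ^ n) => (1 == s ^+ i)%g%:R)) => [|i _];
  last first.
  by rewrite -repr_mx_cycleX; apply: gring_projE; rewrite ?group1 ?mem_cycle.
have pn_gt0 : (0 < p ^ n)%N by rewrite expn_gt0 prime_gt0.
rewrite (bigD1 (Ordinal pn_gt0)) //= expg0 eqxx big1 => [/eqP|i nz_i].
  by rewrite addr0 oner_eq0.
case: eqP => // /esym/eqP; rewrite -order_dvdn ord_s /dvdn modn_small //.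
by rewrite -val_eqE /= in nz_i; rewrite (negPf nz_i).
Qed.

Section CyclicQuotient.

Variable e : nat.
Hypotheses (e_gt0 : (0 < e)%N) (le_e : (e <= p ^ n)%N).
Local Notation V := (cyclic_mx aG (aug_pow p s e)).

Lemma cyclic_aug_pow_mul : V *m U ^+ (p ^ n - e) = 0.
Proof.
have commU x : x \in <[s]>%g -> GRing.comm (aG x) U.
  case/cycleP=> i ->; rewrite repr_mx_cycleX; apply: commrB; last exact: commr1.
  exact/commr_sym/commrX.
apply/sub_kermxP/cyclic_mx_sub; last first.
  by apply/sub_kermxP; rewrite -aug_powD subnKC // aug_pow_order.
apply/mxmoduleP=> x Gx; apply/sub_kermxP.
rewrite -mulmxA mulmxE (commrX _ (commU x Gx)) -mulmxE mulmxA.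
by rewrite mulmx_ker mul0mx.
Qed.

Lemma aug_pow_pred_notin : ~~ (aug_pow p s e.-1 <= V)%MS.
Proof.
apply: contra aug_pow_order_pred => /submxP[B augE].
rewrite (_ : (p ^ n).-1 = e.-1 + (p ^ n - e))%N; last by lia.
by rewrite aug_powD augE -mulmxA cyclic_aug_pow_mul mulmx0.
Qed.

Lemma rank_cyclic_aug_pow : (p ^ n - e <= \rank V)%N.
Proof.
case: (ltngtP e (p ^ n)) le_e => // [lt_e _ | -> _]; last by rewrite subnn.
have /eqP <- : row_free (\matrix_(i < p ^ n - e) (aug_pow p s e *m U ^+ i)).
  apply: nilpotent_chain_free; rewrite -aug_powD;
    first by rewrite subnKC // aug_pow_order.
  by rewrite (_ : _ + _ = (p ^ n).-1)%N ?aug_pow_order_pred //; lia.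
apply/mxrankS/row_subP=> i; rewrite rowK.
elim: (i : nat) => [|j IHj]; first by rewrite mulmx1 cyclic_mx_id.
rewrite exprSr -mulmxE mulmxA mulmxBr mulmx1 addmx_sub ?eqmx_opp //.
by apply: mxmodule_trans; rewrite ?cycle_id // cyclic_mx_module.
Qed.

Lemma decomposes_cyc_mod :
  decomposes (cyc_mod p s e s) (fun _ : unit => ('X - 1) ^+ e).
Proof.
pose modV := cyclic_mx_module aG (aug_pow p s e).
pose w := in_factmod V (aug_pow p s 0).
pose R := factmod_repr modV s.
have wX i : w *m (R - 1%:M) ^+ i = in_factmod V (aug_pow p s i).
  elim: i => [|i IHi]; first by rewrite mulmx1.
  rewrite exprSr -mulmxE mulmxA IHi mulmxBr mulmx1 -(addn1 i) aug_powD expr1.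
  by rewrite mulmxBr mulmx1 linearB /= -in_factmodJ ?cycle_id.
have we : w *m (R - 1%:M) ^+ e = 0.
  by apply/eqP; rewrite wX in_factmod_eq0 cyclic_mx_id.
have we1 : w *m (R - 1%:M) ^+ e.-1 != 0.
  by rewrite wX in_factmod_eq0 aug_pow_pred_notin.
have rank_factV : \rank (cokermx V) = e.
  apply/eqP; rewrite eqn_leq; apply/andP; split; last first.
    by have /eqP {1}<- := nilpotent_chain_free we we1; apply: rank_leq_col.
  rewrite mxrank_coker leq_subLR addnC -leq_subLR.
  by apply: leq_trans rank_cyclic_aug_pow; rewrite leq_sub2r // -ord_s.
by have := decomposes_jordan_block rank_factV we we1; rewrite polyC1.
Qed.

End CyclicQuotient.

Lemma decomposes_muln (r : nat) : exists I : finType,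
  forall (rG : representation 'F_p <[s]>%G) (P : {poly 'F_p}),
    decomposes (rG s) (fun _ : unit => P) ->
  decomposes (muln_grepr rG r s) (fun _ : I => P).
Proof.
rewrite /muln_grepr; elim: r => [|r [I IHr]].
  by exists void => rG P _; rewrite big_ord0; apply: decomposes_void.
exists (unit + I)%type => rG P dec_rG; rewrite big_ord_recl.
exact: decomposes_dsum dec_rG (IHr _ _ dec_rG).
Qed.

Lemma decomposes_cyc_sum N (d : nat -> nat) :
  exists (I : finType) (l : I -> nat),
  (forall j, 0 < l j <= N)%N /\
  forall e, (forall i, 0 < i <= N -> 0 < e i <= p ^ n)%N ->
  decomposes (cyc_sum p s N d e s) (fun j => ('X - 1) ^+ e (l j)).
Proof.
suff [I [l [l_r dec_r]]] : exists (I : finType) (l : I -> nat),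
    (forall j, l j \in index_iota 1 N.+1) /\ forall e : nat -> nat,
    {in index_iota 1 N.+1, forall i, 0 < e i <= p ^ n}%N ->
    decomposes (cyc_sum p s N d e s) (fun j => ('X - 1) ^+ e (l j)).
  exists I, l; split=> [j | e e_bnd].
    by have := l_r j; rewrite mem_index_iota.
  by apply: dec_r => i; rewrite mem_index_iota => /e_bnd.
rewrite /cyc_sum; elim: index_iota => [|i r [I [l [l_r dec_r]]]].
  exists void, (fun=> 0%N); split=> [[] | e _]; rewrite big_nil.
  exact: decomposes_void.
have [Ii dec_i] := decomposes_muln (d i).
exists (Ii + I)%type, (fun j => if j is inr j' then l j' else i);
  split=> [[_|j]|e e_bnd].
- exact: mem_head.
- by rewrite inE l_r orbT.
rewrite big_cons; apply: decomposes_dsum.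
  by apply: dec_i; have /andP[] := e_bnd i (mem_head i r);
    apply: decomposes_cyc_mod.
by apply: dec_r => j rj; rewrite e_bnd // inE rj orbT.
Qed.

End CyclicModules.

(** * Split Kummer modules *)

Section PowerIndependence.

Variables (p : nat) (F : fieldType) (K : splittingFieldType F).
Variable s : gal_of {:K}.
Hypothesis p_pr : prime p.
Local Notation U := ('X - 1 : {poly 'F_p}).

Definition pow_indep (I : finType) (d : I -> {poly 'F_p}) (x : I -> K) : Prop :=
  forall P : {ffun I -> {poly 'F_p}},
    \prod_j gal_exp s (P j) (x j) ~[p] 1 <-> forall j, d j %| P j.

Variable I : finType.
Implicit Types (l : I -> nat) (P : {ffun I -> {poly 'F_p}}) (x y : I -> K).

Lemma gal_exp_single (Q : {poly 'F_p}) j x :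
  \prod_i gal_exp s (ffun_single j Q i) (x i) = gal_exp s Q (x j).
Proof.
rewrite (bigD1 j) //= big1 => [|i /negPf neq_ij]; rewrite ffunE ?eqxx ?mulr1 //.
by rewrite neq_ij gal_exp_poly0.
Qed.

Lemma pow_indep_single d x j (Q : {poly 'F_p}) :
  pow_indep d x -> gal_exp s Q (x j) ~[p] 1 <-> d j %| Q.
Proof.
move=> indep_x; rewrite -gal_exp_single (indep_x _); split=> [/(_ j)|dQ i].
  by rewrite ffunE eqxx.
by rewrite ffunE; case: eqP => [->|_]; rewrite ?dvdp0.
Qed.

Lemma pow_indep_exp d x j : pow_indep d x -> gal_exp s (d j) (x j) ~[p] 1.
Proof. by move=> indep_x; apply/(pow_indep_single _ _ indep_x). Qed.

Lemma pow_indep_pred_neq1 l x j : (0 < l j)%N ->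
  pow_indep (fun i => U ^+ l i) x -> ~ gal_exp s (U ^+ (l j).-1) (x j) ~[p] 1.
Proof.
move=> lj_gt0 indep_x /(pow_indep_single _ _ indep_x).
by rewrite dvdp_Pexp2l ?size_XsubC // leqNgt prednK // leqnn.
Qed.

(* A relation between the y j has, after multiplying by a power of U, all its *)
(* terms in the socles, where it is a relation between the x j.               *)
Lemma pow_indep_same_socle l l' x y :
    (forall j, 0 < l j)%N -> (forall j, 0 < l' j)%N ->
    (forall j, x j != 0) -> (forall j, y j != 0) ->
    (forall j, gal_exp s (U ^+ (l' j).-1) (y j) ~[p]
               gal_exp s (U ^+ (l j).-1) (x j)) ->
  pow_indep (fun j => U ^+ l j) x -> pow_indep (fun j => U ^+ l' j) y.
Proof.
move=> l_gt0 l'_gt0 nzx nzy soc indep_x P; split=> [Py | dP]; last first.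
  apply: eq_pow_prod1 => j _; apply: gal_exp_dvd_eq1 (dP j) _ => //.
  rewrite -(prednK (l'_gt0 j)) exprS gal_exp_polyM // soc.
  rewrite -gal_exp_polyM // -exprS.
  by rewrite prednK //; apply: pow_indep_exp indep_x.
have [M lM] : exists M, forall j, (l' j <= M)%N.
  by exists (\max_j l' j) => j; apply: leq_bigmax.
have: forall j, U ^+ l' j %| P j * U ^+ M.
  by move=> j; rewrite dvdp_mull ?dvdp_exp2l.
elim: M P Py {lM} => [|M IHM] P Py PM.
  by move=> j; have := PM j; rewrite mulr1.
have PU : forall j, U ^+ l' j %| P j * U.
  pose PU := [ffun j => P j * U].
  suff: forall j, U ^+ l' j %| PU j by move=> h j; have := h j; rewrite ffunE.
  apply: IHM => [|j]; last by rewrite ffunE -mulrA -exprS.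
  have -> : \prod_j gal_exp s (PU j) (y j) ~[p]
      gal_exp s U (\prod_j gal_exp s (P j) (y j)).
    by rewrite gal_exp_prod; apply: eq_pow_prod => j _;
      rewrite ffunE mulrC gal_exp_polyM.
  by rewrite Py gal_exp1.
have [Q PE] : exists Q : {ffun I -> {poly 'F_p}},
    forall j, P j = Q j * U ^+ (l' j).-1.
  exists [ffun j => P j %/ U ^+ (l' j).-1] => j; rewrite ffunE divpK //.
  have := PU j.
  by rewrite -{1}(prednK (l'_gt0 j)) exprSr dvdp_mul2r // polyXsubC_eq0.
pose QU := [ffun j => Q j * U ^+ (l j).-1].
have /indep_x dQU : \prod_j gal_exp s (QU j) (x j) ~[p] 1.
  rewrite -[X in _ ~[p] X]Py; apply: eq_pow_prod => j _.
  by rewrite ffunE PE !gal_exp_polyM // soc.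
move=> j; have := dQU j; rewrite ffunE PE.
rewrite -{1}(prednK (l_gt0 j)) -{1}(prednK (l'_gt0 j)).
by rewrite !exprS !dvdp_mul2r ?Xsub1_neq0.
Qed.

Lemma norm_split_pow_indep n l x : #[s]%g = (p ^ n)%N ->
    (forall j, 0 < l j <= p ^ n)%N -> (forall j, x j != 0) ->
    (forall j, norm_split p s (x j)) -> pow_indep (fun j => U ^+ l j) x ->
  forall P, norm_split p s (\prod_j gal_exp s (P j) (x j)).
Proof.
move=> ord_s l_bnd nzx split_x indep_x P; set v := \prod_j _.
have nzv : v != 0 by apply/prodf_neq0=> j _; apply: gal_exp_neq0.
rewrite /norm_split ord_s -gal_exp_Xsub1_norm // gal_exp_prod => Nv.
pose NP := [ffun j => U ^+ (p ^ n).-1 * P j].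
have /indep_x dNP : \prod_j gal_exp s (NP j) (x j) ~[p] 1.
  by rewrite -[X in _ ~[p] X]Nv; apply: eq_pow_prod => j _;
    rewrite ffunE gal_exp_polyM.
apply: norm_fixed_pow_prod => j; have {dNP} := dNP j; rewrite ffunE.
have /andP[lj_gt0] := l_bnd j; rewrite leq_eqVlt => /orP[/eqP-> | lt_lj _];
  last first.
  apply: norm_fixed_pow_gal_exp.
  apply: norm_split_short lt_lj _ _ (split_x j) => //.
  exact: pow_indep_exp indep_x.
have pn_gt0 : (0 < p ^ n)%N by rewrite expn_gt0 prime_gt0.
rewrite -{1}(prednK pn_gt0) exprSr dvdp_mul2l ?Xsub1_neq0 //.
case/dvdpP=> Q ->.
rewrite mulrC gal_exp_polyM // gal_exp_Xsub1 ?gal_exp_neq0 //.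
exact/norm_fixed_pow_coboundary/gal_exp_neq0.
Qed.

End PowerIndependence.

(* phi embeds the dual of the module (column space, X acting as R) in         *)
(* K^* / K^*p; the norm condition makes the extension of F generated by the   *)
(* p-th roots of its values split over K.                                     *)
Record split_kummer (p : nat) (F : fieldType) (K : splittingFieldType F)
    (s : gal_of {:K}) (m : nat) (R : 'M['F_p]_m) (phi : 'cV['F_p]_m -> K) :
    Prop :=
  SplitKummer {
    kummer_neq0 : forall v, phi v != 0;
    kummerD : forall v w, phi (v + w) ~[p] phi v * phi w;
    gal_kummer : forall v, s (phi v) ~[p] phi (R *m v);
    kummer_inj : forall v, phi v ~[p] 1 -> v = 0;
    kummer_norm : forall v, norm_split p s (phi v)
  }.

Section SplitKummer.

Variables (p : nat) (F : fieldType) (K : splittingFieldType F).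
Variables (s : gal_of {:K}) (m : nat) (R : 'M['F_p]_m).
Hypothesis p_pr : prime p.

Section Embedding.

Variable phi : 'cV['F_p]_m -> K.
Hypothesis kummer_phi : split_kummer s R phi.
Let nz_phi := kummer_neq0 kummer_phi.

Lemma kummer0 : phi 0 ~[p] 1.
Proof.
by rewrite -(divff (nz_phi 0)) -{2}[0]addr0 (kummerD kummer_phi) mulfK.
Qed.

Lemma kummer_sum (I : Type) (r : seq I) (f : I -> 'cV_m) :
  phi (\sum_(i <- r) f i) ~[p] \prod_(i <- r) phi (f i).
Proof.
elim: r => [|i r IHr]; first by rewrite !big_nil kummer0.
by rewrite !big_cons (kummerD kummer_phi) IHr.
Qed.

Lemma kummerZ (c : 'F_p) v : phi (c *: v) ~[p] phi v ^+ c.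
Proof.
rewrite -[c in c *: v]natr_Zp scaler_nat -[in phi _](card_ord c) -sumr_const.
by rewrite kummer_sum prodr_const card_ord.
Qed.

Lemma galX_kummer i v : (s ^+ i)%g (phi v) ~[p] phi (R ^+ i *m v).
Proof.
elim: i => [|i IHi]; first by rewrite gal_id mul1mx.
by rewrite galXS IHi (gal_kummer kummer_phi) exprS -mulmxA.
Qed.

Lemma cnorm_kummer r v :
  cnorm s r (phi v) ~[p] phi ((\sum_(i < r) R ^+ i) *m v).
Proof.
by rewrite mulmx_suml kummer_sum; apply: eq_pow_prod => i _; apply: galX_kummer.
Qed.

Variables (I : finType) (d : I -> {poly 'F_p}).
Variable pi : {ffun I -> {poly 'F_p}} -> 'cV['F_p]_m.
Hypothesis pres_pi : presentation R d pi.

Lemma kummer_pres_gen j P :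
  phi (pres_gen pi j P) ~[p] gal_exp s P (phi (pres_gen pi j 1)).
Proof.
have nzg := nz_phi (pres_gen pi j 1).
elim/poly_ind: P => [|P c IHP];
  first by rewrite (pres_gen0 pres_pi) gal_exp_poly0 kummer0.
rewrite gal_exp_polyD // gal_exp_polyMX gal_exp_polyC -IHP -kummerZ.
rewrite (gal_kummer kummer_phi) -(pres_gen_mulX pres_pi).
rewrite -(kummerD kummer_phi) addrC [in X in _ ~[p] X]addrC.
by rewrite -(pres_gen_linear pres_pi) alg_polyC.
Qed.

Lemma kummer_pres (P : {ffun I -> {poly 'F_p}}) :
  phi (pi P) ~[p] \prod_j gal_exp s (P j) (phi (pres_gen pi j 1)).
Proof.
rewrite -(sum_pres_gen pres_pi) kummer_sum.
by apply: eq_pow_prod => j _; apply: kummer_pres_gen.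
Qed.

Lemma pow_indep_kummer : pow_indep s d (fun j => phi (pres_gen pi j 1)).
Proof.
move=> P; rewrite -kummer_pres -(pres_eq0 pres_pi).
by split=> [/(kummer_inj kummer_phi) // | ->]; apply: kummer0.
Qed.

End Embedding.

Lemma split_kummer_of_pow_indep (I : finType) (d : I -> {poly 'F_p})
    (y : I -> K) :
    decomposes R d -> (forall j, y j != 0) -> pow_indep s d y ->
    (forall P : {ffun I -> {poly 'F_p}},
      norm_split p s (\prod_j gal_exp s (P j) (y j))) ->
  exists phi, split_kummer s R phi.
Proof.
case=> pi pres_pi nzy indep_y split_y.
pose Y (P : {ffun I -> {poly 'F_p}}) := \prod_j gal_exp s (P j) (y j).
have nzY P : Y P != 0 by apply/prodf_neq0=> j _; apply: gal_exp_neq0.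
have YD P Q : Y (P + Q) ~[p] Y P * Y Q.
  by rewrite -big_split; apply: eq_pow_prod => j _; rewrite ffunE gal_exp_polyD.
have YX (P : {ffun I -> {poly 'F_p}}) : Y [ffun j => P j * 'X] = s (Y P).
  by rewrite rmorph_prod; apply: eq_bigr => j _; rewrite ffunE gal_exp_polyMX.
have Y1 P : Y P ~[p] 1 <-> pi P = 0 by rewrite (indep_y P) (pres_eq0 pres_pi).
have piD := presD pres_pi.
have Y_eq P Q : pi P = pi Q -> Y P ~[p] Y Q.
  move=> PQ; rewrite -[P](subrK Q) YD (iffRL (Y1 (P - Q))) ?mul1r //.
  by apply: (addIr (pi Q)); rewrite -piD subrK add0r.
have surj_pi v : exists P, pi P == v.
  by have [P <-] := pres_surj pres_pi v; exists P.
pose lift v := xchoose (surj_pi v).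
have pi_lift v : pi (lift v) = v by apply/eqP/(xchooseP (surj_pi v)).
exists (fun v => Y (lift v)); split=> [v | v w | v | v /Y1 | v].
- exact: nzY.
- by rewrite -YD; apply: Y_eq; rewrite piD !pi_lift.
- by rewrite -YX; apply: Y_eq; rewrite (pres_mulX pres_pi) !pi_lift.
- by rewrite pi_lift.
- exact: split_y.
Qed.

End SplitKummer.

Lemma split_kummer_lift (p n : nat) (F : fieldType) (K : splittingFieldType F)
    (s : gal_of {:K}) (z : K) m (R : 'M['F_p]_m) m' (R' : 'M['F_p]_m')
    (I : finType) (l : I -> nat) phi :
    prime p -> p.-primitive_root z -> s z = z -> #[s]%g = (p ^ n)%N ->
    (forall j, 0 < l j <= p ^ n)%N ->
    decomposes R (fun j => ('X - 1) ^+ l j) ->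
    decomposes R' (fun j => ('X - 1) ^+ (p ^ up_log p (l j))) ->
  split_kummer s R phi -> exists phi', split_kummer s R' phi'.
Proof.
move=> p_pr prim_z sz ord_s l_bnd [pi pres_pi] dec_R' kummer_phi.
set U := 'X - 1 : {poly 'F_p} in pres_pi dec_R'.
have l_gt0 j : (0 < l j)%N by case/andP: (l_bnd j).
pose x j := phi (pres_gen pi j 1).
have nzx j : x j != 0 := kummer_neq0 kummer_phi _.
have indep_x : pow_indep s (fun j => U ^+ l j) x.
  exact: (pow_indep_kummer p_pr kummer_phi pres_pi).
have lift_x j := length_lift p_pr prim_z sz ord_s (l_bnd j) (nzx j)
  (pow_indep_exp j indep_x) (pow_indep_pred_neq1 (l_gt0 j) indep_x)
  (@kummer_norm _ _ _ _ _ _ _ kummer_phi _).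
have [y yP] := fin_all_exists lift_x.
have nzy j : y j != 0 by case: (yP j).
have ceil_bnd j := expn_up_log_bounds p_pr (l_bnd j).
have indep_y : pow_indep s (fun j => U ^+ (p ^ up_log p (l j))) y.
  apply: pow_indep_same_socle l_gt0 _ nzx nzy _ indep_x => // j.
  - by case/andP: (ceil_bnd j).
  - by case: (yP j).
apply: (split_kummer_of_pow_indep p_pr dec_R' nzy indep_y).
by apply: norm_split_pow_indep ord_s ceil_bnd nzy _ indep_y => // j;
  case: (yP j).
Qed.

(** * Galois groups that are semidirect products *)

(* 'Gal({:L} / 1) is the semidirect product of the normal subgroup a('rV_m)   *)
(* and <[t]>, with t acting as sigma.                                         *)
Record split_gal (p : nat) (gT : finGroupType) (sigma : gT) (m : nat)
    (A : mx_representation 'F_p <[sigma]>%G m) (F : fieldType)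
    (L : splittingFieldType F) (t : gal_of {:L})
    (a : 'rV['F_p]_m -> gal_of {:L}) : Prop := SplitGal {
  split_inj : injective a;
  splitD : forall u v, a (u + v) = (a u * a v)%g;
  split_conj : forall u, (a u ^ t)%g = a (u *m A sigma);
  split_gen : forall x, exists i u, x = (t ^+ i * a u)%g;
  split_tri : forall i u, (t ^+ i)%g = a u -> (#[sigma]%g %| i)%N;
  split_order : #[t]%g = #[sigma]%g
}.

Section SplitRealization.

Variables (p : nat) (gT : finGroupType) (sigma : gT) (m : nat).
Variables (A : mx_representation 'F_p <[sigma]>%G m) (F : fieldType).
Local Notation to := ('MR A)%gact.

Lemma realizes_split_gal : realizes F (modsdprod A) ->
  exists (L : splittingFieldType F) (t : gal_of {:L}) a,
    galois 1 {:L} /\ split_gal A t a.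
Proof.
case=> L [galL]; rewrite isog_sym => /isogP[f injf imf].
exists L, (f (sdpair2 to sigma)), (fun u => f (sdpair1 to u)); split=> //.
have fM x y : f (x * y)%g = (f x * f y)%g by rewrite morphM ?inE.
have fX x i : f (x ^+ i)%g = (f x ^+ i)%g by rewrite morphX ?inE.
have f_inj : injective f by move=> x y /(injmP injf); apply; rewrite inE.
have tri i u : (sdpair2 to sigma ^+ i)%g = sdpair1 to u -> (#[sigma]%g %| i)%N.
  rewrite -morphX ?cycle_id //= => sigma_u.
  have : sdpair2 to (sigma ^+ i)%g \in
      (sdpair1 to @* [set: 'rV['F_p]_m] :&: sdpair2 to @* <[sigma]>)%g.
    by rewrite inE {1}sigma_u !mem_morphim ?inE ?mem_cycle.
  rewrite im_sdpair_TI => /set1P sigma1; rewrite order_dvdn; apply/eqP.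
  by apply: (injmP (injm_sdpair2 to)); rewrite ?mem_cycle ?group1 ?morph1.
split.
- by move=> u v /f_inj/(injmP (injm_sdpair1 to)); apply; rewrite inE.
- by move=> u v; rewrite -fM -morphM ?inE.
- move=> u; rewrite -[LHS](morphJ f) ?inE // -sdpair_act ?inE ?cycle_id //.
  by rewrite /= mx_repr_actE ?cycle_id.
- move=> x; have : x \in (f @* [set: sdprod_by to])%g.
    by rewrite imf mem_gal_full.
  case/morphimP=> y _ _ ->; have := sdpairE y.
  case: y => [[c u] cu] /= yE; case/setXP: (cu) => /= /cycleP[i ci] _.
  by exists i, u; rewrite {1}yE fM /= ci morphX ?cycle_id //= fX.
- by move=> i u; rewrite -fX => /f_inj/tri.
- by rewrite order_injm ?inE // order_injm ?injm_sdpair2 ?cycle_id.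
Qed.

Lemma split_gal_realizes (L : splittingFieldType F) (t : gal_of {:L}) a :
  galois 1 {:L} -> split_gal A t a -> realizes F (modsdprod A).
Proof.
move=> galL [a_inj aD a_conj a_gen a_tri ord_t]; exists L; split=> //.
have aM : {in [set: 'rV['F_p]_m] &, {morph a : u v / (u * v)%g >-> (u * v)%g}}.
  by move=> u v _ _; rewrite FinRing.zmodMgE aD.
have dvd_t : (#[t]%g %| #[sigma]%g)%N by rewrite ord_t.
have a_conjX u i : (a u ^ (t ^+ i))%g = a (u *m A (sigma ^+ i)%g).
  elim: i => [|i IHi]; first by rewrite conjg1 repr_mx1 mulmx1.
  rewrite expgSr conjgM IHi a_conj -mulmxA expgSr.
  by rewrite repr_mxM ?mem_cycle ?cycle_id.
pose fH := Morphism aM; pose fK := eltm_morphism dvd_t.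
have actf : {in [set: 'rV['F_p]_m] & <[sigma]>%g, morph_act to 'J fH fK}.
  move=> u _ _ /cycleP[i ->] /=; rewrite mx_repr_actE ?mem_cycle //.
  by rewrite (eltmE dvd_t) a_conjX.
rewrite isog_sym; apply/isogP; exists [morphism of xsdprodm actf].
  rewrite injm_xsdprodm; apply/and3P; split.
  - by apply/injmP => u v _ _; apply: a_inj.
  - by rewrite injm_eltm ord_t.
  - apply/eqP/trivgP/subsetP => x /setIP[/morphimP[u _ _ ->]].
    case/morphimP=> _ _ /cycleP[i ->]; rewrite /= (eltmE dvd_t) => au_ti.
    have := a_tri i u (esym au_ti); rewrite -ord_t order_dvdn => /eqP ti1.
    by rewrite au_ti ti1 group1.
rewrite im_xsdprodm; apply/eqP; rewrite eqEsubset; apply/andP; split.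
  by apply/subsetP=> x _; apply: mem_gal_full.
apply/subsetP=> x _; have [i [u ->]] := a_gen x.
have [j tj] : exists j, ((t ^+ i)^-1 = t ^+ j)%g.
  by apply/cycleP; rewrite groupV mem_cycle.
rewrite conjgCV tj a_conjX mem_mulg ?(mem_morphim fH) ?inE //.
by rewrite -(eltmE dvd_t) mem_morphim ?mem_cycle.
Qed.

End SplitRealization.

(** * Embeddings of Galois extensions *)

Section AlgebraMorphism.

Variables (F : fieldType) (K L : fieldExtType F) (i : 'AHom(K, L)).

Lemma memv_limgP (y : L) : reflect (exists e, y = i e) (y \in limg i).
Proof.
apply: (iffP memv_imgP) => [[e _ ->] | [e ->]]; first by exists e.
by exists e; rewrite ?memvf.
Qed.

Lemma ahom_inj : injective i.
Proof. exact: fmorph_inj. Qed.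

Lemma ahom_eq0 e : (i e == 0) = (e == 0).
Proof. exact: fmorph_eq0. Qed.

Lemma ahom_alg (c : F) : i c%:A = c%:A.
Proof. exact: rmorph_alg. Qed.

Lemma map_ahom_alg (P : {poly F}) :
  map_poly i (map_poly (in_alg K) P) = map_poly (in_alg L) P.
Proof. by rewrite -map_poly_comp; apply: eq_map_poly => c; apply: ahom_alg. Qed.

Lemma map_ahom_over1 (P : {poly K}) :
  P \is a polyOver 1%VS -> map_poly i P \is a polyOver 1%VS.
Proof.
by case/polyOver1P=> P0 ->; apply/polyOver1P; exists P0; apply: map_ahom_alg.
Qed.

Lemma map_ahom_splits (P : {poly K}) (rs : seq K) :
  (map_poly i P %= \prod_(y <- map i rs) ('X - y%:P)) =
    (P %= \prod_(y <- rs) ('X - y%:P)).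
Proof. by rewrite -(eqp_map i) prod_map_poly. Qed.

Lemma limg_adjoin1 (rs : seq K) : (i @: <<1 & rs>>)%VS = <<1 & map i rs>>%VS.
Proof. by rewrite aimg_adjoin_seq aimg1. Qed.

End AlgebraMorphism.

Section GaloisEmbedding.

Variables (F : fieldType) (K L : splittingFieldType F) (i : 'AHom(K, L)).
Implicit Types (x t : gal_of {:L}) (s : gal_of {:K}) (e : K).

Lemma limg_ahom_normal : normalField 1 (i @: {:K}).
Proof.
have [Q Q1 [rs QE rs_gen]] := splittingPoly K.
apply/(splitting_normalField (sub1v (i @: {:K})%AS)); exists (map_poly i Q).
  exact: map_ahom_over1.
by exists (map i rs); rewrite ?map_ahom_splits // -limg_adjoin1 rs_gen.
Qed.

Lemma gal_restrict x : exists s, forall e, i (s e) = x (i e).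
Proof.
have xE : (x @: limg i <= limg i)%VS.
  have /forall_inP/(_ x) := limg_ahom_normal.
  by rewrite inE kAutfE k1AHom => /(_ isT)/eqP->.
pose f := (i^-1 \o (x \o i))%VF : 'End(K).
have fE e : i (f e) = x (i e).
  by rewrite !comp_lfunE limg_lfunVK // (subvP xE) // !memv_img ?memvf.
have kf : kAut 1 {:K} f.
  rewrite kAutfE; apply/kHomP_tmp; split=> [_ /vlineP[c ->] | u v _ _];
    apply: ahom_inj.
    by apply: etrans (fE _) _; rewrite !rmorph_alg.
  by apply: etrans (fE _) _; rewrite !rmorphM /= -!fE.
have [s _ sE] := kAut_to_gal kf.
by exists s => e; rewrite -sE ?memvf.
Qed.

Lemma gal_extend s : exists t, forall e, t (i e) = i (s e).
Proof.
pose f := (i \o (s \o i^-1))%VF : 'End(L).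
have fE e : f (i e) = i (s e).
  rewrite !comp_lfunE; congr (i (s _)); apply: (@ahom_inj _ _ _ i).
  by rewrite limg_lfunVK // memv_img ?memvf.
have homf : kHom 1 (limg i) f.
  apply/kHomP_tmp;
    split=> [_ /vlineP[c ->] | _ _ /memv_limgP[u ->] /memv_limgP[v ->]].
    by rewrite -(ahom_alg i) fE; congr (i _); apply: rmorph_alg.
  rewrite -[i u * i v](rmorphM i) fE [X in i X](rmorphM _).
  by rewrite [LHS](rmorphM i) !fE.
have [||t _ tE] := @kHom_to_gal F L 1%AS (i @: {:K})%AS {:L}%AS f _ _ homf.
- by rewrite sub1v subvf.
- exact: normalFieldf.
by exists t => e; rewrite -fE tE //; apply/memv_limgP; exists e.
Qed.

Lemma mem_gal_limgP x :
  reflect (forall e, x (i e) = i e) (x \in 'Gal({:L} / limg i)%g).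
Proof.
rewrite (gal_kHom x (subvf (i @: {:K})%AS)).
apply: (iffP kAHomP) => [xE e | xE _ /memv_limgP[e ->] //].
by rewrite xE //; apply/memv_limgP; exists e.
Qed.

Lemma galX_ext t s j e :
  (forall e, t (i e) = i (s e)) -> (t ^+ j)%g (i e) = i ((s ^+ j)%g e).
Proof. by move=> tE; elim: j => [|j IHj]; rewrite ?gal_id // !galXS IHj tE. Qed.

Lemma galV_ext t s e :
  (forall e, t (i e) = i (s e)) -> t^-1%g (i e) = i (s^-1%g e).
Proof. by move=> tE; rewrite -{1}[e](galVK_full s) -tE galK_full. Qed.

End GaloisEmbedding.

Section SubfieldType.

Variables (F : fieldType) (L : splittingFieldType F) (E : {subfield L}).
Let incl : 'AHom(subvs_of E, L) := linfun_ahom vsval.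

Lemma limg_subvs : limg incl = E.
Proof.
apply/vspaceP=> y; apply/memv_limgP/idP => [[u ->] | Ey].
  by rewrite lfunE subvsP.
by exists (vsproj E y); rewrite lfunE /= vsprojK.
Qed.

Lemma subvs_splitting : normalField 1 E -> SplittingField.axiom (subvs_of E).
Proof.
case/(splitting_normalField (sub1v E)) => P /polyOver1P[P0 ->] [rs P_rs rs_gen].
have [zs rsE] : exists zs, rs = map incl zs.
  exists (map (vsproj E) rs); rewrite -map_comp map_id_in // => y rs_y.
  by rewrite /= lfunE /= vsprojK // -rs_gen seqv_sub_adjoin.
exists (map_poly (in_alg _) P0); first by apply/polyOver1P; exists P0.
exists zs; first by rewrite -(map_ahom_splits incl) map_ahom_alg -rsE.
apply/eqP; rewrite -(eq_limg_ker0 _ _ (AHom_lker0 incl)) limg_adjoin1 -rsE.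
by rewrite rs_gen limg_subvs.
Qed.

Lemma normal_subfield_embedding : normalField 1 E ->
  exists (K : splittingFieldType F) (i : 'AHom(K, L)), limg i = E.
Proof.
move=> /subvs_splitting split_E.
pose mix := FieldExt_isSplittingField.Build F (subvs_of E) split_E.
pose K : splittingFieldType F := HB.pack (subvs_of E) mix.
by exists K, incl; apply: limg_subvs.
Qed.

End SubfieldType.

(** * Splitting fields *)

Lemma baseField_embedding (F : fieldType) (K : fieldExtType F)
    (L : fieldExtType K) (ys : seq L) : <<1 & ys>>%VS = {:L}%VS ->
  exists2 i : 'AHom(K, baseFieldType L), forall e, i e = e%:A :> L
    & <<limg i & (ys : seq (baseFieldType L))>>%VS = {:baseFieldType L}%VS.
Proof.
move=> ys_gen; pose L0 := baseFieldType L; pose f (e : K) : L0 := (e%:A : L).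
have f_lin : linear f.
  move=> c u v; rewrite /f scalerDl baseField_scaleE scalerA; congr (_ + _).
  by rewrite mulr_algl.
pose fL := GRing.isLinear.Build F K L0 *:%R f f_lin.
pose fl : {linear K -> L0} := HB.pack f fL.
have fE e : linfun fl e = e%:A :> L by rewrite lfunE.
have f_hom : ahom_in {:K} (linfun fl).
  apply/ahomP_tmp; split; first by apply: etrans (fE _) _; rewrite scale1r.
  move=> u v; apply: etrans (fE _) _.
  have -> : (linfun fl u * linfun fl v : L) = u%:A * v%:A :> L by rewrite !fE.
  exact: (rmorphM (in_alg L)).
pose i := AHom f_hom; exists i => //.
pose V := <<limg i & (ys : seq L0)>>%AS.
have sub_V : (refBaseField L <= V)%VS.
  apply/subvP=> e; rewrite refBaseField.unlock mem_baseVspace => /vlineP[c ->].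
  apply: (subvP (subv_adjoin_seq _ _)); apply/memv_imgP; exists c;
    first exact: memvf.
  exact: esym (fE c).
have [E VE memE] := module_baseAspace sub_V.
have EL : (E : {vspace L}) = {:L}%VS.
  apply/eqP; rewrite eqEsubv subvf -ys_gen; apply/Fadjoin_seqP; split.
    exact: sub1v.
  by move=> y ys_y; rewrite -memE seqv_sub_adjoin.
apply/eqP; rewrite eqEsubv subvf; apply/subvP=> e _.
by move: (@memvf K L e); rewrite -EL -memE.
Qed.

Lemma irreducible_factor (K : fieldType) (P : {poly K}) : (1 < size P)%N ->
  exists2 r, r %| P & irreducible_poly r.
Proof.
have [n] := ubnP (size P); elim: n P => // n IHn P lt_n P_gt1.
case: (classic (irreducible_poly P)) => [irrP | redP]; first by exists P.
have [q q_dvd [q_neq1 q_neqP]] :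
    exists2 q, q %| P & size q != 1%N /\ ~~ (q %= P).
  apply: NNPP => noq; apply: redP; split=> // q q1 qP; apply/negPn/negP => qnP.
  by apply: noq; exists q.
have nzP : P != 0 by rewrite -size_poly_gt0 ltnW.
have q_gt1 : (1 < size q)%N.
  by rewrite ltn_neqAle eq_sym q_neq1 size_poly_gt0 (dvdpN0 q_dvd).
have q_lt : (size q < size P)%N.
  by rewrite ltn_neqAle dvdp_leq // andbT; apply: contra q_neqP;
    rewrite dvdp_size_eqp.
have [|r r_q irr_r] := IHn q _ q_gt1; first exact: leq_trans q_lt lt_n.
by exists r => //; apply: dvdp_trans r_q q_dvd.
Qed.

Lemma splitting_field_exists (K : fieldType) (P : {poly K}) : P != 0 ->
  exists (L : fieldExtType K) (ys : seq L),
    map_poly (in_alg L) P %= \prod_(y <- ys) ('X - y%:P)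
    /\ <<1 & ys>>%VS = {:L}%VS.
Proof.
have [n] := ubnP (size P); elim: n => // n IHn in K P * => lt_n nzP.
have [P_le1 | P_gt1] := leqP (size P) 1.
  exists K^o, [::]; rewrite big_nil Fadjoin_nil regular_fullv; split=> //.
  by rewrite -size_poly_eq1 size_map_poly eqn_leq P_le1 size_poly_gt0.
have [r r_dvd irr_r] := irreducible_factor P_gt1.
have [K1 _ [x rx x_gen]] := irredp_FAdjoin irr_r.
have /factor_theorem[q PE] : root (map_poly (in_alg K1) P) x.
  by rewrite -(divpK r_dvd) rmorphM rootM rx orbT.
have szP : size P = size (q * ('X - x%:P)) by rewrite -PE size_map_poly.
have nzq : q != 0.
  by move: nzP; rewrite -size_poly_eq0 szP size_poly_eq0 mulf_eq0 => /norP[].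
have [|L [ys [qE ys_gen]]] := IHn K1 q _ nzq.
  by rewrite ltnS szP size_mul ?polyXsubC_eq0 ?size_XsubC ?addn2 in lt_n.
have [i iE i_gen] := baseField_embedding ys_gen.
exists (baseFieldType L), (i x :: (ys : seq (baseFieldType L))); split.
  rewrite -(map_ahom_alg i) PE rmorphM big_cons mulrC /= map_polyXsubC.
  have -> : map_poly i q = map_poly (in_alg L) q.
    by apply: eq_map_poly => c; rewrite /= iE.
  exact: eqp_mull.
rewrite adjoin_cons -i_gen; congr (<<_ & _>>%VS).
by rewrite -(aimg1 i) -aimg_adjoin x_gen.
Qed.

Lemma adjoin_cat (F : fieldType) (L : fieldExtType F) (K : {subfield L}) r1 r2 :
  <<K & r1 ++ r2>>%VS = <<<<K & r1>> & r2>>%VS.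
Proof.
elim: r1 K => [|x r IHr] K; first by rewrite Fadjoin_nil.
by rewrite !adjoin_cons IHr.
Qed.

Lemma adjoin_roots (F : fieldType) (K : splittingFieldType F) (P : {poly K}) :
    P != 0 -> P \is a polyOver 1%VS ->
  exists (L : splittingFieldType F) (i : 'AHom(K, L)) (ys : seq L),
    map_poly i P %= \prod_(y <- ys) ('X - y%:P) /\ <<limg i & ys>>%VS = {:L}%VS.
Proof.
move=> nzP P1; have [L [ys [PE ys_gen]]] := splitting_field_exists nzP.
have [i iE i_gen] := baseField_embedding ys_gen.
have [Q Q1 [rs QE rs_gen]] := splittingPoly K.
have iP : map_poly i P = map_poly (in_alg L) P.
  by apply: eq_map_poly => c; rewrite /= iE.
have split_L : SplittingField.axiom (baseFieldType L).
  exists (map_poly i (Q * P)); first by rewrite map_ahom_over1 // rpredM.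
  exists (map i rs ++ (ys : seq (baseFieldType L))).
    rewrite big_cat rmorphM /= iP; apply: eqp_trans (eqp_mull _ PE).
    by apply: eqp_mulr; rewrite -(map_ahom_splits i) in QE.
  by rewrite -i_gen -rs_gen limg_adjoin1; apply: (adjoin_cat 1%AS).
pose mix := FieldExt_isSplittingField.Build F (baseFieldType L) split_L.
pose L1 : splittingFieldType F := HB.pack (baseFieldType L) mix.
by exists L1, i, ys; split; rewrite ?iP.
Qed.

(** * Kummer theory of split extensions *)

Section PrimeRootsOfUnity.

Variables (p : nat) (R : fieldType) (w : R).
Hypotheses (p_pr : prime p) (prim_w : p.-primitive_root w).
Implicit Types a b : 'F_p.

Lemma prim_exprD_Fp a b : w ^+ (a + b)%R = w ^+ a * w ^+ b.
Proof. by rewrite -exprD -[RHS](prim_expr_mod prim_w) val_FpD. Qed.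

Lemma prim_expr_inj_Fp a b : w ^+ a = w ^+ b -> a = b.
Proof.
move/eqP; rewrite (eq_prim_root_expr prim_w) => /eqP.
have lt_p (c : 'F_p) : (c < p)%N by rewrite -[X in (_ < X)%N](Fp_cast p_pr).
by rewrite !modn_small // => /val_inj.
Qed.

End PrimeRootsOfUnity.

Lemma prim_root_alg (p : nat) (F : fieldType) (z : F) :
    p.-primitive_root z ->
  forall L : splittingFieldType F, p.-primitive_root (z%:A : L).
Proof. by move=> prim_z L; rewrite (fmorph_primitive_root (in_alg L)). Qed.

Section KummerPairing.

Variables (p : nat) (F : fieldType) (z : F).
Hypotheses (p_pr : prime p) (prim_z : p.-primitive_root z).
Variables (K L : splittingFieldType F) (i : 'AHom(K, L)) (m : nat).
Variables (phi : 'cV['F_p]_m -> K) (beta : 'cV['F_p]_m -> L).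
Hypothesis nz_phi : forall v, phi v != 0.
Hypothesis beta_p : forall v, beta v ^+ p = i (phi v).
Implicit Types (x t : gal_of {:L}) (u : 'rV['F_p]_m) (v : 'cV['F_p]_m).
Local Notation zL := (z%:A : L).

Let prim_zL := prim_root_alg prim_z L.

Lemma gal_alg_exp x r : x (zL ^+ r) = zL ^+ r.
Proof. by rewrite rmorphXn /= rmorph_alg. Qed.

Lemma prim_expr_neq0 r : zL ^+ r != 0.
Proof. by rewrite expf_neq0 // (prim_root_eq0 prim_zL) -lt0n prime_gt0. Qed.

Lemma pth_root_neq0 v : beta v != 0.
Proof.
apply: contraNneq (nz_phi v) => b0; rewrite -(ahom_eq0 i) -beta_p b0.
by rewrite expr0n gtn_eqF ?prime_gt0.
Qed.

(* x acts on the p-th roots of the values of phi through the linear form u    *)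
(* on columns.                                                                *)
Definition kummer_pairing x u : bool :=
  [forall v, x (beta v) == zL ^+ ((u *m v) 0 0)%R * beta v].

Lemma kummer_pairingP x u :
  reflect (forall v, x (beta v) = zL ^+ ((u *m v) 0 0)%R * beta v)
    (kummer_pairing x u).
Proof. by apply: (iffP forallP) => xu v; apply/eqP/xu. Qed.

Lemma kummer_pairing1 : kummer_pairing 1%g 0.
Proof. by apply/kummer_pairingP=> v; rewrite gal_id mul0mx mxE expr0 mul1r. Qed.

Lemma kummer_pairingM x x' u u' :
    kummer_pairing x u -> kummer_pairing x' u' ->
  kummer_pairing (x * x')%g (u + u').
Proof.
move=> /kummer_pairingP xu /kummer_pairingP xu'; apply/kummer_pairingP=> v.
rewrite galM_full xu rmorphM /= gal_alg_exp xu' mulmxDl [(_ + _ : 'M_1) 0 0]mxE.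
by rewrite prim_exprD_Fp // mulrA.
Qed.

Lemma kummer_pairing_uniq x u u' :
  kummer_pairing x u -> kummer_pairing x u' -> u = u'.
Proof.
move=> /kummer_pairingP xu /kummer_pairingP xu'; apply/rowP=> j.
have := xu (delta_mx j 0); rewrite xu' => /(mulIf (pth_root_neq0 _)).
by move/(prim_expr_inj_Fp p_pr prim_zL); rewrite -!colE !mxE.
Qed.

Lemma kummer_pairing_root x u v c y : kummer_pairing x u ->
    (forall e, x (i e) = i e) -> y ~[p] phi v -> c ^+ p = i y ->
  x c = zL ^+ ((u *m v) 0 0)%R * c.
Proof.
move=> /kummer_pairingP xu xi [w nzw ->] cp.
have nzbw : beta v * i w != 0 by rewrite mulf_neq0 ?pth_root_neq0 ?ahom_eq0.
have [|j ->] := prim_root_exp_eq prim_zL nzbw (x := c).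
  by rewrite cp exprMn beta_p rmorphM rmorphXn.
by rewrite !rmorphM /= gal_alg_exp xi xu -!mulrA mulrCA.
Qed.

End KummerPairing.

Lemma ahom_pth_root (p : nat) (F : fieldType) (z : F)
    (K L : splittingFieldType F) (i : 'AHom(K, L)) (w : K) (y : L) :
  p.-primitive_root z -> w != 0 -> y ^+ p = i w ^+ p -> exists e, y = i e.
Proof.
move=> prim_z nzw yp.
have [|j ->] := prim_root_exp_eq (prim_root_alg prim_z L) _ yp;
  first by rewrite ahom_eq0.
by exists ((z%:A) ^+ j * w); rewrite rmorphM rmorphXn /= ahom_alg.
Qed.

Section KummerOfSplit.

Variables (p : nat) (F : fieldType) (z : F).
Hypotheses (p_pr : prime p) (prim_z : p.-primitive_root z).

Lemma kummer_eigenvector (L : splittingFieldType F) (V : finZmodType)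
    (a : V -> gal_of {:L}) (k : V -> 'F_p) :
    injective a -> (forall u v, a (u + v) = (a u * a v)%g) ->
    (forall u v, k (u + v) = k u + k v) ->
  exists2 b : L, b != 0 & forall u, a u b = (z%:A : L) ^+ k u * b.
Proof.
move=> a_inj aD kD; set zL := z%:A.
have k0 : k 0 = 0 by apply: (addrI (k 0)); rewrite -kD !addr0.
have kN u : k (- u) = - k u by apply: (addrI (k u)); rewrite -kD !subrr.
pose w u := zL ^+ k (- u).
have w_sub u v : w (u - v) = zL ^+ k v * w u.
  by rewrite /w opprB kD prim_exprD_Fp ?prim_root_alg.
have gal_w (x : gal_of {:L}) u : x (w u) = w u by apply: gal_alg_exp.
pose c_ y := \sum_(u | a u == y) w u.
have [|c _] := @gal_independent_contra F L _ xpredT c_ (a 0) isT.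
  rewrite /c_ (big_pred1 0) => [|u]; last by rewrite /= (inj_eq a_inj).
  by rewrite /w oppr0 k0 expr0 oner_neq0.
have -> : \sum_y c_ y * y c = \sum_u w u * a u c.
  rewrite [RHS](partition_big a xpredT) //=; apply: eq_bigr => y _.
  by rewrite mulr_suml; apply: eq_bigr => u /eqP->.
set b := \sum_u _ => nzb; exists b => // v.
rewrite rmorph_sum /= mulr_sumr (reindex_inj (addIr (- v))) /=.
apply: eq_bigr => u _; rewrite rmorphM /= gal_w w_sub mulrA; congr (_ * _).
by rewrite -galM_full -aD subrK.
Qed.

Variables (gT : finGroupType) (sigma : gT) (m : nat).
Variable A : mx_representation 'F_p <[sigma]>%G m.
Variables (L : splittingFieldType F) (t : gal_of {:L}).
Variable a : 'rV['F_p]_m -> gal_of {:L}.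
Hypotheses (galL : galois 1 {:L}) (split_a : split_gal A t a).

Lemma split_gal_morphM :
  {in [set: 'rV['F_p]_m] &, {morph a : u v / (u * v)%g >-> (u * v)%g}}.
Proof. by move=> u v _ _; rewrite FinRing.zmodMgE (splitD split_a). Qed.

Definition split_kernel : {group gal_of {:L}} :=
  (Morphism split_gal_morphM @* [set: 'rV['F_p]_m])%G.

Lemma split_kernelP x : reflect (exists u, x = a u) (x \in split_kernel).
Proof.
apply: (iffP morphimP) => [[u _ _ ->] | [u ->]]; first by exists u.
by exists u; rewrite ?inE.
Qed.

Lemma split_kernel_normal : (split_kernel <| 'Gal({:L} / 1))%g.
Proof.
apply/andP; split; first by apply/subsetP=> x _; apply: mem_gal_full.
apply/subsetP=> x _; have [i [u ->]] := split_gen split_a x.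
rewrite groupM ?groupX //; last first.
  by apply/(subsetP (normG _))/split_kernelP; exists u.
rewrite inE; apply/subsetP=> _ /imsetP[y /split_kernelP[v ->] ->].
by rewrite (split_conj split_a); apply/split_kernelP; exists (v *m A sigma).
Qed.

Lemma mem_fixed_split_kernel e :
  reflect (forall u, a u e = e) (e \in fixedField split_kernel).
Proof.
apply: (iffP (fixedFieldP (memvf e))) => [fe u | fe x /split_kernelP[u ->] //].
by apply: fe; apply/split_kernelP; exists u.
Qed.

Lemma split_fixed_embedding :
  exists (K : splittingFieldType F) (i : 'AHom(K, L)) (s : gal_of {:K}),
  [/\ forall y, (forall u, a u y = y) <-> exists e, y = i e,
      forall e, t^-1%g (i e) = i (s e),
      #[s]%g = #[sigma]%g
    & forall e, s e = e -> e \in 1%VS].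
Proof.
have /and3P[_ _ normal_E] := normal_fixedField_galois galL split_kernel_normal.
have [K [i imi]] := normal_subfield_embedding normal_E.
have [s sE] := gal_restrict i t^-1%g.
have fixE y : (forall u, a u y = y) <-> exists e, y = i e.
  have imiP : reflect (exists e, y = i e) (y \in fixedField split_kernel).
    by rewrite -[fixedField _]imi; apply: memv_limgP.
  by split=> [/mem_fixed_split_kernel/imiP | /imiP/mem_fixed_split_kernel].
have tE e : t^-1%g (i e) = i (s e) by rewrite sE.
exists K, i, s; split=> // [|e se].
- apply/eqP; rewrite -(split_order split_a) eqn_dvd !order_dvdn.
  apply/andP; split.
    apply/eqP/eqP/gal_eqP => e _; apply: (@ahom_inj _ _ _ i).
    by rewrite -(galX_ext _ _ tE) expgVn expg_order invg1 !gal_id.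
  rewrite -order_dvdn (split_order split_a).
  have : (t^-1 ^+ #[s])%g \in split_kernel.
    rewrite -(gal_fixedField split_kernel) gal_kHom ?fixedField_bound //.
    apply/kAHomP=> y /mem_fixed_split_kernel fix_y.
    have [e ->] := iffLR (fixE y) fix_y.
    by rewrite (galX_ext _ _ tE) expg_order gal_id.
  by rewrite expgVn groupV => /split_kernelP[u]; apply: (split_tri split_a).
- have te : t (i e) = i e by rewrite -{1}se -tE galVK_full.
  have : i e \in 1%VS.
    rewrite -(galois_fixedField galL).
    apply/fixedFieldP; rewrite ?memvf // => x _.
    have [j [u ->]] := split_gen split_a x; rewrite galM_full gal_fixX //.
    by apply: (iffRL (fixE (i e))); exists e.
  case/vlineP=> c; rewrite -(ahom_alg i) => /ahom_inj->.
  by apply/vlineP; exists c.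
Qed.

Variables (K : splittingFieldType F) (i : 'AHom(K, L)) (s : gal_of {:K}).
Hypothesis fixE : forall y, (forall u, a u y = y) <-> exists e, y = i e.
Hypothesis tE : forall e, t^-1%g (i e) = i (s e).
Local Notation zL := (z%:A : L).

Lemma kummer_eigen_eq_pow (k : 'rV['F_p]_m -> nat) b c x y :
    c != 0 -> (forall u, a u b = zL ^+ k u * b) ->
    (forall u, a u c = zL ^+ k u * c) -> b != 0 ->
    i x = b ^+ p -> i y = c ^+ p ->
  x ~[p] y.
Proof.
move=> nzc ab ac nzb xb yc.
have [u|w bc] := iffLR (fixE (b / c)).
  rewrite rmorphM fmorphV /= ab ac invfM mulrACA.
  by rewrite divff ?mul1r // (prim_expr_neq0 p_pr prim_z).
exists w; first by rewrite -(ahom_eq0 i) -bc mulf_neq0 ?invr_eq0.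
apply: (@ahom_inj _ _ _ i); apply: etrans xb _.
by rewrite rmorphM rmorphXn /= yc -bc expr_div_n mulrC divfK ?expf_neq0.
Qed.

Variables (phi : 'cV['F_p]_m -> K) (beta : 'cV['F_p]_m -> L).
Hypothesis nz_beta : forall v, beta v != 0.
Hypothesis beta_p : forall v, i (phi v) = beta v ^+ p.
Hypothesis a_beta : forall u v, a u (beta v) = zL ^+ ((u *m v) 0 0)%R * beta v.

Lemma eq_pow_eigenvector v b x : b != 0 ->
    (forall u, a u b = zL ^+ ((u *m v) 0 0)%R * b) -> i x = b ^+ p ->
  x ~[p] phi v.
Proof.
move=> nzb ab xb.
exact: (kummer_eigen_eq_pow (nz_beta v) ab (a_beta^~ v) nzb xb).
Qed.

Lemma eigenvector_kummer_inj v : phi v ~[p] 1 -> v = 0.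
Proof.
case=> w nzw; rewrite mul1r => phi_w.
have [|e be] := ahom_pth_root (i := i) prim_z nzw (y := beta v);
  first by rewrite -beta_p phi_w rmorphXn.
have uv0 (u : 'rV_m) : (u *m v) 0 0 = 0.
  apply: (prim_expr_inj_Fp p_pr (prim_root_alg prim_z L)).
  apply: (mulIf (nz_beta v)).
  rewrite expr0 mul1r; apply: etrans (esym (a_beta u v)) _.
  by apply: (iffRL (fixE (beta v))); exists e.
by apply/colP=> j; have := uv0 (delta_mx 0 j); rewrite -rowE !mxE.
Qed.

Hypothesis ord_s : #[s]%g = #[sigma]%g.

Lemma eigenvector_norm_split v : norm_split p s (phi v).
Proof.
case=> w nzw; rewrite mul1r => Nv; pose C := cnorm t^-1%g #[s]%g (beta v).
have Cp : C ^+ p = i (cnorm s #[s]%g (phi v)).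
  rewrite -cnormX -beta_p rmorph_prod; apply: eq_bigr => j _.
  exact: galX_ext.
have [|c CE] := ahom_pth_root (i := i) prim_z nzw (y := C);
  first by rewrite Cp Nv rmorphXn.
have tC : t^-1%g C = C.
  apply/cnorm_fixP; rewrite // ord_s -(split_order split_a).
  by rewrite expgVn expg_order invg1 gal_id.
exists c; apply: (@ahom_inj _ _ _ i); first by rewrite -tE -CE.
by apply: etrans (esym Cp) _; rewrite CE rmorphXn.
Qed.

Lemma kummer_of_split_gal : split_kummer s (A sigma) phi.
Proof.
split=> [v | v w | v | v | v].
- by rewrite -(ahom_eq0 i) beta_p expf_neq0.
- symmetry; apply: (eq_pow_eigenvector (b := beta v * beta w)) => [|u|].
  + by rewrite mulf_neq0.
  + rewrite rmorphM /= !a_beta mulmxDr [(_ + _ : 'M_1) 0 0]mxE.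
    by rewrite (prim_exprD_Fp p_pr (prim_root_alg prim_z L)) mulrACA.
  + by rewrite rmorphM /= !beta_p exprMn.
- apply: (eq_pow_eigenvector (b := t^-1%g (beta v))) => [|u|].
  + by rewrite gal_neq0.
  + have -> : a u (t^-1%g (beta v)) = t^-1%g (a (u *m A sigma) (beta v)).
      by rewrite -!galM_full -(split_conj split_a) conjgE -!mulgA mulgV mulg1.
    by rewrite a_beta rmorphM /= gal_alg_exp mulmxA.
  + by rewrite -tE beta_p rmorphXn.
- exact: eigenvector_kummer_inj.
- exact: eigenvector_norm_split.
Qed.

End KummerOfSplit.

Lemma realizes_kummer (p : nat) (F : fieldType) (z : F)
    (gT : finGroupType) (sigma : gT) (m : nat)
    (A : mx_representation 'F_p <[sigma]>%G m) :
    prime p -> p.-primitive_root z -> realizes F (modsdprod A) ->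
  exists (K : splittingFieldType F) (s : gal_of {:K}) (phi : 'cV['F_p]_m -> K),
  [/\ #[s]%g = #[sigma]%g, forall e, s e = e -> e \in 1%VS
    & split_kummer s (A sigma) phi].
Proof.
move=> p_pr prim_z /realizes_split_gal[L [t [a [galL split_a]]]].
have [K [i [s [fixE tE ord_s fix_s]]]] := split_fixed_embedding galL split_a.
have eigen (v : 'cV['F_p]_m) : exists2 b : L, b != 0
    & forall u, a u b = (z%:A : L) ^+ ((u *m v) 0 0)%R * b.
  have [a_inj aD _ _ _ _] := split_a.
  apply: (kummer_eigenvector p_pr prim_z a_inj aD) => u u'.
  by rewrite mulmxDl mxE.
have [beta nz_beta a_beta] := fin_all_exists2 eigen.
have zL_p r : ((z%:A : L) ^+ r) ^+ p = 1.
  by rewrite exprAC (prim_expr_order (prim_root_alg prim_z L)) expr1n.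
have root_fixed v : exists e, i e = beta v ^+ p.
  have [u|e ->] := iffLR (fixE (beta v ^+ p)); last by exists e.
  by rewrite rmorphXn /= a_beta exprMn zL_p mul1r.
have [phi beta_p] := fin_all_exists root_fixed.
exists K, s, phi; split=> //.
exact: (kummer_of_split_gal p_pr prim_z split_a fixE tE nz_beta beta_p _ ord_s).
Qed.

(** * Radical extensions with prescribed module *)

Section RadicalExtension.

Variables (p : nat) (F : fieldType) (K : splittingFieldType F).
Variable s : gal_of {:K}.
Hypotheses (p_gt0 : (0 < p)%N) (fix_s : forall e, s e = e -> e \in 1%VS).
Variables (X : finType) (f : X -> K).

(* The product of the conjugates of 'X^p - f x has coefficients in F, so its  *)
(* splitting field over K is a splitting field over F.                        *)
Definition radical_poly : {poly K} :=
  \prod_(j < #[s]%g) \prod_x ('X^p - ((s ^+ j)%g (f x))%:P).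

Lemma radical_poly_neq0 : radical_poly != 0.
Proof. by do 2!(apply/prodf_neq0=> ? _); apply/monic_neq0/monicXnsubC. Qed.

Lemma radical_poly_over1 : radical_poly \is a polyOver 1%VS.
Proof.
apply/polyOverP=> e; apply: fix_s.
pose G j := \prod_x ('X^p - ((s ^+ j)%g (f x))%:P).
have sG j : map_poly s (G j) = G j.+1.
  rewrite rmorph_prod; apply: eq_bigr => x _.
  by rewrite rmorphB /= map_polyXn map_polyC /= galXS.
suff mP : map_poly s radical_poly = radical_poly by rewrite -[LHS]coef_map mP.
rewrite -[radical_poly]/(\prod_(j < #[s]%g) G j) rmorph_prod /=.
under eq_bigr do rewrite sG.
rewrite -(prednK (order_gt0 s)) big_ord_recr [RHS]big_ord_recl mulrC /=.
rewrite prednK ?order_gt0 //; congr (_ * _).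
by apply: eq_bigr => x _; rewrite expg_order.
Qed.

Lemma radical_extension :
  exists (L : splittingFieldType F) (i : 'AHom(K, L)) (ys : seq L),
  [/\ {in ys, forall y, exists j x, y ^+ p = i ((s ^+ j)%g (f x))},
      forall x, exists b, b ^+ p = i (f x)
    & <<limg i & ys>>%VS = {:L}%VS].
Proof.
have [L [i [ys [ysP ys_gen]]]] :=
  adjoin_roots radical_poly_neq0 radical_poly_over1.
have iP : map_poly i radical_poly =
    \prod_(j < #[s]%g) \prod_x ('X^p - (i ((s ^+ j)%g (f x)))%:P).
  do 2!(rewrite rmorph_prod; apply: eq_bigr => ? _).
  by rewrite rmorphB /= map_polyXn map_polyC.
rewrite iP in ysP; exists L, i, ys; split=> // [y|x].
  rewrite -root_prod_XsubC -(eqp_root ysP) rootE horner_prod => /prodf_eq0[j _].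
  rewrite horner_prod => /prodf_eq0[x _]; rewrite !hornerE subr_eq0 => /eqP yp.
  by exists j, x.
have dvd_ys : 'X^p - (i (f x))%:P %| \prod_(y <- ys) ('X - y%:P).
  rewrite -(eqp_dvdr _ ysP) (bigD1 (Ordinal (order_gt0 s))) //= (bigD1 x) //=.
  by rewrite gal_id -!mulrA dvdp_mulr.
have [msk mE] := dvdp_prod_XsubC dvd_ys.
case: (mask msk ys) mE => [|y r] mE.
  have := eqp_size mE; rewrite big_nil size_poly1 size_XnsubC //.
  by case: (p) p_gt0.
exists y; apply/eqP; rewrite -subr_eq0.
have : root ('X^p - (i (f x))%:P) y.
  by rewrite (eqp_root mE) root_prod_XsubC mem_head.
by rewrite rootE !hornerE.
Qed.

End RadicalExtension.

Lemma rV_Fp_nondegenerate_full (p m : nat) (S : {set 'rV['F_p]_m}) :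
    0 \in S -> {in S &, forall u v, u + v \in S} ->
    (forall v : 'cV_m, {in S, forall u : 'rV_m, u *m v = 0} -> v = 0) ->
  S = setT.
Proof.
move=> S0 SD nondeg; apply/setP=> u; rewrite inE.
pose M := \matrix_(r < #|S|) enum_val r.
have /submxP[c ->] : (u <= M)%MS.
  apply: submx_full; rewrite /row_full -mxrank_tr; apply: inj_row_free => v vM.
  apply: trmx_inj; rewrite trmx0; apply: nondeg => w Sw.
  have := congr1 (fun B => (row (enum_rank_in Sw w) B^T)) vM.
  by rewrite trmx_mul trmxK row_mul rowK enum_rankK_in // trmx0 row0.
have SMn v k : v \in S -> v *+ k \in S.
  by move=> Sv; elim: k => [|k IHk]; rewrite ?mulr0n // mulrS SD.
rewrite mulmx_sum_row; elim/big_ind: _ => // r _.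
by rewrite rowK -[c 0 r]natr_Zp scaler_nat SMn ?enum_valP.
Qed.

Lemma additive_cV_Fp (p m : nat) (g : 'cV['F_p]_m -> 'F_p) :
  {morph g : v w / v + w} -> exists u : 'rV_m, forall v, g v = (u *m v) 0 0.
Proof.
move=> gD; have g0 : g 0 = 0 by apply: (addrI (g 0)); rewrite -gD !addr0.
have gMn v k : g (v *+ k) = g v *+ k.
  by elim: k => [|k IHk]; rewrite ?mulr0n // !mulrS gD IHk.
exists (\row_j g (delta_mx j 0)) => v.
rewrite {1}[v]matrix_sum_delta (big_morph g gD g0) mxE; apply: eq_bigr => j _.
rewrite big_ord1 mxE -[v j 0 in LHS]natr_Zp scaler_nat gMn.
by rewrite -mulr_natr natr_Zp.
Qed.

Section SplitOfKummer.

Variables (p : nat) (F : fieldType) (z : F).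
Hypotheses (p_pr : prime p) (prim_z : p.-primitive_root z).
Variables (K : splittingFieldType F) (s : gal_of {:K}).
Variables (m : nat) (R : 'M['F_p]_m).
Variable phi : 'cV['F_p]_m -> K.
Hypothesis fix_s : forall e, s e = e -> e \in 1%VS.
Hypothesis kummer_phi : split_kummer s R phi.
Variables (L : splittingFieldType F) (i : 'AHom(K, L)) (ys : seq L).
Hypothesis ys_root :
  {in ys, forall y, exists j v, y ^+ p = i ((s ^+ j)%g (phi v))}.
Hypothesis ys_gen : <<limg i & ys>>%VS = {:L}%VS.
Variable beta : 'cV['F_p]_m -> L.
Hypothesis beta_p : forall v, beta v ^+ p = i (phi v).
Implicit Types (x t : gal_of {:L}) (u : 'rV['F_p]_m) (v : 'cV['F_p]_m).
Local Notation zL := (z%:A : L).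
Local Notation N := 'Gal({:L} / limg i)%g.
Local Notation pairing := (kummer_pairing z beta).

Let prim_zL := prim_root_alg prim_z L.
Let nz_phi := kummer_neq0 kummer_phi.
Let nz_beta := pth_root_neq0 p_pr nz_phi beta_p.

Lemma radical_galois : galois (i @: {:K}) {:L}.
Proof.
rewrite /galois subvf normalFieldf andbT /= -ys_gen.
apply: (@separable_Fadjoin_seq _ _ (i @: {:K})%AS);
  apply/allP=> y /ys_root[j [v yp]].
have nzy : y ^+ p != 0 by rewrite yp ahom_eq0 gal_neq0.
have iE e : i e \in limg i by apply/memv_limgP; exists e.
apply/separable_elementP; exists ('X^p - (y ^+ p)%:P); split.
- by rewrite rpredB ?rpredX ?polyOverX ?polyOverC //= yp iE.
- by rewrite rootE !hornerE subrr.
rewrite unlock; apply/Bezout_coprimepP; exists (p%:R, - 'X) => /=.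
have nzp : p%:R != 0 :> L := prim_root_natf_neq0 prim_zL.
rewrite derivB derivXn derivC subr0 mulNr mulrnAr -exprS prednK ?prime_gt0 //.
rewrite -['X^p *+ p]mulr_natl mulrBr addrAC subrr add0r.
by rewrite -polyC_natr -polyCM -polyCN polyC_eqp1 oppr_eq0 mulf_neq0.
Qed.

Lemma fixed_by_radical_gal y :
  (forall x, x \in N -> x y = y) -> exists e, y = i e.
Proof.
move=> fix_y; apply/memv_limgP; rewrite -[limg i]/(asval (i @: {:K})%AS).
rewrite -(galois_fixedField radical_galois).
by apply/fixedFieldP; rewrite ?memvf.
Qed.

Lemma kummer_pairing_exists x : x \in N -> exists u, pairing x u.
Proof.
move=> /mem_gal_limgP xi.
have eigen v : exists c : 'F_p, x (beta v) = zL ^+ c * beta v.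
  have [|j ->] := prim_root_exp_eq prim_zL (nz_beta v) (x := x (beta v)).
    by rewrite -rmorphXn /= beta_p xi.
  by exists j%:R; rewrite val_Fp_nat // modn_small.
have [g gE] := fin_all_exists eigen.
have gD : {morph g : v w / v + w}.
  move=> v w; have [c nzc phiD] := kummerD kummer_phi v w.
  have nzD : beta v * beta w * i c != 0 by rewrite !mulf_neq0 ?ahom_eq0.
  have [|j betaD] := prim_root_exp_eq prim_zL nzD (x := beta (v + w)).
    by rewrite !exprMn !beta_p phiD !rmorphM rmorphXn.
  apply: (prim_expr_inj_Fp p_pr prim_zL); rewrite (prim_exprD_Fp p_pr prim_zL).
  apply: (mulIf (nz_beta (v + w)));
    rewrite -gE betaD !rmorphM /= gal_alg_exp xi !gE.
  by ring.
have [u uE] := additive_cV_Fp gD; exists u.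
by apply/kummer_pairingP=> v; rewrite gE uE.
Qed.

Lemma kummer_pairing0_eq1 x : x \in N -> pairing x 0 -> x = 1%g.
Proof.
move=> Nx x0; have xi := elimT (mem_gal_limgP i x) Nx.
have xL : (<<i @: {:K} & ys>> <= fixedField [set x])%VS.
  apply/(@Fadjoin_seqP _ _ (i @: {:K})%AS _ (fixedField_aspace [set x])); split.
    apply/subvP=> _ /memv_limgP[e ->]; apply/fixedFieldP; rewrite ?memvf //.
    by move=> _ /set1P->.
  move=> y /ys_root[j [v yp]].
  apply/fixedFieldP; rewrite ?memvf // => _ /set1P->.
  have sj_phi := galX_kummer kummer_phi j v.
  rewrite (kummer_pairing_root p_pr prim_z nz_phi beta_p x0 xi sj_phi yp).
  by rewrite mul0mx mxE expr0 mul1r.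
apply/eqP/gal_eqP=> e _; rewrite gal_id.
have : e \in fixedField [set x] by apply: (subvP xL); rewrite ys_gen memvf.
by case/mem_fixedFieldP=> _; apply; apply: set11.
Qed.

Lemma kummer_pairing_eq x x' u :
  x \in N -> x' \in N -> pairing x u -> pairing x' u -> x = x'.
Proof.
move=> Nx Nx' xu x'u; apply: (mulIg x'^-1%g); rewrite mulgV.
have [u' x'Vu'] := kummer_pairing_exists (groupVr Nx').
apply: kummer_pairing0_eq1; first by rewrite groupM ?groupV.
have uu' : u + u' = 0.
  have pairing1 := kummer_pairing1 z beta.
  apply: (kummer_pairing_uniq p_pr prim_z nz_phi beta_p _ pairing1).
  by rewrite -(mulgV x') kummer_pairingM.
by rewrite -uu' kummer_pairingM.
Qed.

Lemma kummer_pairing_surj u : exists2 x, x \in N & pairing x u.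
Proof.
pose S := [set u' | [exists x in N, pairing x u']].
suff : u \in S by rewrite inE => /exists_inP[x]; exists x.
suff -> : S = setT by rewrite inE.
apply: rV_Fp_nondegenerate_full => [|u1 u2|v Sv].
- by rewrite inE; apply/exists_inP; exists 1%g;
    rewrite ?group1 ?kummer_pairing1.
- rewrite !inE => /exists_inP[x1 Nx1 xu1] /exists_inP[x2 Nx2 xu2].
  by apply/exists_inP; exists (x1 * x2)%g; rewrite ?groupM ?kummer_pairingM.
have [x Nx | e be] := @fixed_by_radical_gal (beta v).
  have [u' xu'] := kummer_pairing_exists Nx.
  rewrite (elimT (kummer_pairingP _ _ _ _) xu') Sv ?mxE ?expr0 ?mul1r //.
  by rewrite inE; apply/exists_inP; exists x.
apply: (kummer_inj kummer_phi); exists e; first by rewrite -(ahom_eq0 i) -be.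
by apply: (@ahom_inj _ _ _ i); rewrite -beta_p be mul1r rmorphXn.
Qed.

(* With s^-1 instead of s, conjugation by t on the pairings is u *m R, the    *)
(* transpose of the action of R on columns.                                   *)
Definition lifts t := forall e, t (i e) = i (s^-1%g e).

Lemma lifts_inv t e : lifts t -> t^-1%g (i e) = i (s e).
Proof. by move=> tE; rewrite (galV_ext e tE) invgK. Qed.

Lemma lifts_mul t x : lifts t -> x \in N -> lifts (t * x)%g.
Proof. by move=> tE /mem_gal_limgP xi e; rewrite galM_full tE xi. Qed.

Lemma kummer_pairing_conj t x u : lifts t -> x \in N -> pairing x u ->
  (x ^ t)%g \in N /\ pairing (x ^ t)%g (u *m R).
Proof.
move=> tE Nx xu; have xi := elimT (mem_gal_limgP i x) Nx.
have xtE y : (x ^ t)%g y = t (x (t^-1%g y)) by rewrite conjgE !galM_full.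
split.
  by apply/mem_gal_limgP=> e; rewrite xtE (lifts_inv _ tE) xi tE galK_full.
apply/kummer_pairingP=> v; rewrite xtE.
have s_phi := gal_kummer kummer_phi v.
rewrite (kummer_pairing_root p_pr prim_z nz_phi beta_p xu xi s_phi).
  by rewrite rmorphM /= gal_alg_exp galVK_full mulmxA.
by rewrite -rmorphXn /= beta_p lifts_inv.
Qed.

Lemma lifts_pow_mem t : lifts t -> (t ^+ #[s]%g)%g \in N.
Proof.
by move=> tE; apply/mem_gal_limgP=> e;
  rewrite (galX_ext _ _ tE) expgVn expg_order invg1 gal_id.
Qed.

(* On a column v killed by the norm of R, the norm condition makes the norm   *)
(* of beta v fixed by t, and so t ^+ #[s] fixes beta v.                       *)
Lemma lifts_pow_pairing t u : lifts t -> pairing (t ^+ #[s]%g)%g u ->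
  (u <= (\sum_(j < #[s]%g) R ^+ j)%R)%MS.
Proof.
move=> tE tu; set NR := \sum_(j < _) _; pose T := t^-1%g.
suff killed v : NR *m v = 0 -> (u *m v) 0 0 = 0.
  rewrite submxE; apply/eqP/rowP=> j; rewrite [RHS]mxE.
  have := killed (cokermx NR *m delta_mx j 0).
  by rewrite (mulmxA NR) (mulmxA u) mulmx_coker mul0mx -colE mxE; apply.
move=> NRv; have [|c sc Nc] := kummer_norm kummer_phi (v := v).
  by rewrite (cnorm_kummer kummer_phi) NRv (kummer0 kummer_phi).
have nzc : i c != 0.
  rewrite ahom_eq0; apply: contraTneq (cnorm_neq0 s #[s]%g (nz_phi v)) => c0.
  by rewrite Nc c0 expr0n gtn_eqF ?prime_gt0 ?eqxx.
have [|j CE] := prim_root_exp_eq prim_zL nzc (x := cnorm T #[s]%g (beta v)).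
  rewrite -cnormX beta_p -rmorphXn -Nc rmorph_prod; apply: eq_bigr => j _.
  by apply: galX_ext => e; apply: lifts_inv.
have Tv : (T ^+ #[s])%g (beta v) = beta v.
  apply/cnorm_fixP=> //; rewrite CE rmorphM /= gal_alg_exp /T lifts_inv //.
  by rewrite sc.
apply: (prim_expr_inj_Fp p_pr prim_zL); apply: (mulIf (nz_beta v)).
rewrite -(elimT (kummer_pairingP _ _ _ _) tu) expr0 mul1r.
by rewrite -{1}Tv /T expgVn galVK_full.
Qed.

Lemma exists_lift_pow1 : exists2 t, lifts t & (t ^+ #[s] = 1)%g.
Proof.
have [t0 t0E] := gal_extend i s^-1%g.
have [u0 t0u] := kummer_pairing_exists (lifts_pow_mem t0E).
have /submxP[u1 u1E] := lifts_pow_pairing t0E t0u.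
have [x1 Nx1 xu1] := kummer_pairing_surj (- u1).
exists (t0 * x1)%g; first exact: lifts_mul.
have powE c : exists x, [/\ x \in N, pairing x (- u1 *m \sum_(j < c) R ^+ j)
                          & ((t0 * x1) ^+ c = t0 ^+ c * x)%g].
  elim: c => [|c [x [Nx xc tc]]].
    by exists 1%g; rewrite group1 mulg1 big_ord0 mulmx0 kummer_pairing1.
  have [Nxt xt] := kummer_pairing_conj t0E Nx xc.
  exists (x ^ t0 * x1)%g; split; first by rewrite groupM.
    have := kummer_pairingM p_pr prim_z xt xu1; congr pairing.
    rewrite big_ord_recl mulmxDr mulmx1 addrC -mulmxA mulmx_suml.
    congr (_ + _ *m _).
    by apply: eq_bigr => j _; rewrite mulmxE -exprSr.
  by rewrite expgSr tc expgSr conjgE -!mulgA mulKVg.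
have [x [Nx xq ->]] := powE #[s]%g.
apply: kummer_pairing0_eq1; first by rewrite groupM ?lifts_pow_mem.
by rewrite -(subrr u0) {2}u1E -mulNmx kummer_pairingM.
Qed.

Lemma radical_galois_base : galois 1 {:L}.
Proof.
apply/galois_fixedField/eqP.
rewrite eqEsubv andbC galois_connection_subv ?sub1v //=.
apply/subvP=> y /mem_fixedFieldP[_ fix_y].
have [x _|e yE] := @fixed_by_radical_gal y; first exact/fix_y/mem_gal_full.
have [t tE] := gal_extend i s^-1%g.
have /fix_s/vlineP[c eE] : s e = e.
  apply: (@ahom_inj _ _ _ i); rewrite -(lifts_inv e tE) -yE.
  exact/fix_y/mem_gal_full.
by rewrite yE eE ahom_alg; apply/vlineP; exists c.
Qed.

Lemma fixedField_cycle_base : fixedField <[s]>%g = 1%VS.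
Proof.
apply/eqP; rewrite eqEsubv sub1v andbT.
apply/subvP=> e /mem_fixedFieldP[_ fix_e].
exact/fix_s/fix_e/cycle_id.
Qed.

Lemma lifts_factor t x :
  lifts t -> exists c x', x' \in N /\ x = (t ^+ c * x')%g.
Proof.
move=> tE; have [s' s'E] := gal_restrict i x.
have /cycleP[c s'c] : s' \in <[s^-1]>%g.
  rewrite cycleV -[<[s]>%g](gal_fixedField <[s]>%G) /=.
  by rewrite fixedField_cycle_base mem_gal_full.
exists c, ((t ^+ c)^-1 * x)%g; rewrite mulKVg; split=> //.
apply/mem_gal_limgP=> e; rewrite galM_full.
have tcE e' : (t ^+ c)%g (i e') = i (s' e') by rewrite s'c; apply: galX_ext.
by rewrite (galV_ext _ tcE) -s'E galVK_full.
Qed.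

Lemma split_gal_of_kummer (gT : finGroupType) (sigma : gT)
    (A : mx_representation 'F_p <[sigma]>%G m) :
    A sigma = R -> #[s]%g = #[sigma]%g -> exists t a, split_gal A (L := L) t a.
Proof.
move=> AR ord_s; have [t tE tq] := exists_lift_pow1.
have [a Na a_pair] := fin_all_exists2 kummer_pairing_surj.
have a_eq x u : x \in N -> pairing x u -> x = a u.
  by move=> Nx xu; apply: kummer_pairing_eq xu (a_pair u).
have t_tri c u : (t ^+ c)%g = a u -> (#[sigma]%g %| c)%N.
  move=> tcu; rewrite -ord_s -orderV order_dvdn; apply/eqP/eqP/gal_eqP => e _.
  apply: (@ahom_inj _ _ _ i); rewrite -(galX_ext c e tE) tcu gal_id.
  exact: (elimT (mem_gal_limgP i _)).
exists t, a; split=> [u u' auu' | u u' | u | x | // |].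
- by apply: (kummer_pairing_uniq p_pr prim_z nz_phi beta_p (a_pair u));
    rewrite auu'.
- by apply/esym/a_eq; rewrite ?groupM ?kummer_pairingM.
- by have [Nut ut] := kummer_pairing_conj tE (Na u) (a_pair u); rewrite AR;
    apply: a_eq.
- have [c [x' [Nx' ->]]] := lifts_factor x tE.
  have [u x'u] := kummer_pairing_exists Nx'.
  by exists c, u; rewrite (a_eq _ _ Nx' x'u).
- apply/eqP; rewrite eqn_dvd order_dvdn -ord_s tq eqxx ord_s /=.
  by apply: (t_tri _ 0); rewrite expg_order; apply: a_eq;
    rewrite ?group1 ?kummer_pairing1.
Qed.

End SplitOfKummer.

Lemma kummer_realizes (p : nat) (F : fieldType) (z : F)
    (K : splittingFieldType F) (s : gal_of {:K})
    (gT : finGroupType) (sigma : gT) (m : nat)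
    (A : mx_representation 'F_p <[sigma]>%G m) (phi : 'cV['F_p]_m -> K) :
    prime p -> p.-primitive_root z -> #[s]%g = #[sigma]%g ->
    (forall e, s e = e -> e \in 1%VS) -> split_kummer s (A sigma) phi ->
  realizes F (modsdprod A).
Proof.
move=> p_pr prim_z ord_s fix_s kummer_phi.
have [L [i [ys [ys_root root_ex ys_gen]]]] :=
  radical_extension (prime_gt0 p_pr) fix_s phi.
have [beta beta_p] := fin_all_exists root_ex.
have [t [a split_a]] := split_gal_of_kummer p_pr prim_z fix_s kummer_phi
  ys_root ys_gen beta_p (erefl (A sigma)) ord_s.
apply: split_gal_realizes split_a.
exact: (radical_galois_base p_pr prim_z fix_s kummer_phi ys_root ys_gen).
Qed.

Lemma prim_root_descent (p n : nat) (F : fieldType) (K : splittingFieldType F)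
    (s : gal_of {:K}) (z : K) :
    prime p -> galois 1 {:K} -> ('Gal({:K} / 1) = <[s]>)%g ->
    #[s]%g = (p ^ n)%N -> p.-primitive_root z ->
  exists z0 : F, p.-primitive_root z0.
Proof.
move=> p_pr galK galE ord_s prim_z.
have [c _ sz] := aut_prim_rootP s prim_z.
have sX j : (s ^+ j)%g z = z ^+ (c ^ j).
  by elim: j => [|j IHj];
    rewrite ?gal_id // galXS IHj rmorphXn /= sz -exprM expnS.
have fermat j : c ^ (p ^ j) = c %[mod p].
  elim: j => // j IHj; rewrite expnSr expnM -modnXm IHj modnXm.
  exact: fermat_little.
have fix_z : s z = z.
  have := sX (p ^ n)%N; rewrite -ord_s expg_order gal_id ord_s sz => {2}->.
  by apply/eqP; rewrite (eq_prim_root_expr prim_z) fermat.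
have /vlineP[z0 zE] : z \in 1%VS.
  rewrite -(galois_fixedField galK) galE; apply/fixedFieldP; rewrite ?memvf //.
  by move=> _ /cycleP[j ->]; apply: gal_fixX.
exists z0; rewrite -(fmorph_primitive_root (in_alg K)) /=.
by rewrite -zE.
Qed.

Theorem theorem1p2 (p n : nat) (F : fieldType) (K : splittingFieldType F)
    (sigma : gal_of {:K}) (d : nat -> nat) (m : nat)
    (A : mx_representation 'F_p <[sigma]>%G m)
    (p_prime : prime p) (n_ge1 : (1 <= n)%N)
    (galKF : galois 1 {:K})
    (GalKF : ('Gal({:K} / 1) = <[sigma]>)%g)
    (ord_sigma : #[sigma]%g = (p ^ n)%N)
    (mu_p : exists z : K, p.-primitive_root z)
    (A_decomp : mx_rsim A (cyc_sum p sigma (p ^ n) d id)) :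
  realizes F (modsdprod A) ->
  realizes F (modsdprod (ceil_mod p sigma (p ^ n) d)).
Proof.
have [zK prim_zK] := mu_p.
have [z prim_z] := prim_root_descent p_prime galKF GalKF ord_sigma prim_zK.
have [I [l [l_bnd dec_sum]]] := decomposes_cyc_sum p_prime ord_sigma (p ^ n) d.
have dec_A : decomposes (A sigma) (fun j => ('X - 1) ^+ l j).
  case: A_decomp => B mE freeB AB.
  exact: (decomposes_sim mE freeB (AB _ (cycle_id _)) (dec_sum id _)).
have dec_ceil := dec_sum (fun i => p ^ up_log p i)%N
  (fun i => expn_up_log_bounds p_prime).
case/(realizes_kummer p_prime prim_z) => K1 [s [phi [ord_s fix_s kummer_phi]]].
have [phi' kummer_phi'] := split_kummer_lift p_prime (prim_root_alg prim_z K1)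
  (rmorph_alg s z) (etrans ord_s ord_sigma) l_bnd dec_A dec_ceil kummer_phi.
exact: (kummer_realizes p_prime prim_z ord_s fix_s kummer_phi').
Qed.
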